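(* Let $f\in L_1(\mathbb R)$ be of bounded variation on $\mathbb R$. Let $\mathbf a=\{a_k\}_{k\ge0}$ with $\operatorname{Im}a_k>0$ have no limit points on the real axis $\mathbb R$, satisfy $\lim_{n\to\infty}\sigma_n=+\infty$, and satisfy $\varsigma_n/\sigma_n\le C$ for all $n\ge1$ with a constant $C$. Then at every point $x_0\in\mathbb R$, $$\lim_{n\to\infty}S_n(f;\mathbf a;x_0)=\frac{f(x_0-0)+f(x_0+0)}{2}.$$
   Context: Let $\Phi_n^+$ ($n\ge0$) be built from $\mathbf a$ and $\Phi_n^-$ ($n\ge1$) from $b_k:=\overline{a_{k-1}}$ ($k\ge1$) as follows: $\chi_k^+:=\frac{|1+a_k^2|}{1+a_k^2}$, $B_0^+:=1$, $B_n^+(z):=\prod_{k=0}^{n-1}\chi_k^+\frac{z-a_k}{z-\overline{a_k}}$, $\Phi_n^+(z):=\frac{\sqrt{\operatorname{Im}a_n}}{z-\overline{a_n}}B_n^+(z)$; $\chi_k^-:=\frac{|1+b_k^2|}{1+b_k^2}$, $B_1^-:=1$, $B_n^-(z):=\prod_{k=1}^{n-1}\chi_k^-\frac{z-b_k}{z-\overline{b_k}}$, $\Phi_n^-(z):=\frac{\sqrt{-\operatorname{Im}b_n}}{z-\overline{b_n}}B_n^-(z)$ (unimodular constants $\chi$ taken to be $1$ if the denominator vanishes); $\Phi_n:=\Phi_n^+$ for $n\ge0$, $\Phi_n:=\Phi_{-n}^-$ for $n\le-1$. For integrable $f$ let $c_k:=\frac1\pi\int_{-\infty}^\infty f(t)\overline{\Phi_k(t)}\,dt$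 and $S_n(f;\mathbf a;x):=\sum_{k=-n}^{n-1}c_k\Phi_k(x)$. $\sigma_n:=\sum_{k=0}^{n-1}\frac{|\operatorname{Im}a_k|}{1+|a_k|^2}$, $\varsigma_n:=\sum_{k=0}^{n-1}\frac{1}{(\operatorname{Im}a_k)^2}$. ''No limit points on $\mathbb R$'' means no subsequence of $\{a_k\}$ converges to a real number. $f(x_0\pm0)$ denote one-sided limits. *)

(* Defs.v *)
From Stdlib Require Import Reals Lra ZArith.
Open Scope R_scope.

Definition Cx : Type := (R * R)%type.
Definition CRe (z : Cx) : R := fst z.
Definition CIm (z : Cx) : R := snd z.
Definition RtoC (x : R) : Cx := (x, 0).
Definition C0 : Cx := (0, 0).
Definition C1 : Cx := (1, 0).
Definition Cadd (z w : Cx) : Cx := (fst z + fst w, snd z + snd w).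
Definition Copp (z : Cx) : Cx := (- fst z, - snd z).
Definition Csub (z w : Cx) : Cx := Cadd z (Copp w).
Definition Cmul (z w : Cx) : Cx :=
  (fst z * fst w - snd z * snd w, fst z * snd w + snd z * fst w).
Definition Cscale (r : R) (z : Cx) : Cx := (r * fst z, r * snd z).
Definition Cconj (z : Cx) : Cx := (fst z, - snd z).
Definition Cnorm2 (z : Cx) : R := fst z * fst z + snd z * snd z.
Definition Cmod (z : Cx) : R := sqrt (Cnorm2 z).
Definition Cinv (z : Cx) : Cx := (fst z / Cnorm2 z, - snd z / Cnorm2 z).
Definition Cdiv (z w : Cx) : Cx := Cmul z (Cinv w).

Fixpoint Rsum (n : nat) (u : nat -> R) : R :=
  match n with O => 0 | S m => Rsum m u + u m end.
Fixpoint Csum (n : nat) (u : nat -> Cx) : Cx :=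
  match n with O => C0 | S m => Cadd (Csum m u) (u m) end.
Fixpoint Cprod (n : nat) (u : nat -> Cx) : Cx :=
  match n with O => C1 | S m => Cmul (Cprod m u) (u m) end.

Definition chi (w : Cx) : Cx :=
  let d := Cadd C1 (Cmul w w) in
  match Req_EM_T (Cnorm2 d) 0 with
  | left _ => C1
  | right _ => Cscale (Cmod d) (Cinv d)
  end.

Definition Bfac (w z : Cx) : Cx :=
  Cmul (chi w) (Cdiv (Csub z w) (Csub z (Cconj w))).

Definition bseq (a : nat -> Cx) (k : nat) : Cx := Cconj (a (Nat.pred k)).

Definition Bplus (a : nat -> Cx) (n : nat) (z : Cx) : Cx :=
  Cprod n (fun k => Bfac (a k) z).
Definition Phiplus (a : nat -> Cx) (n : nat) (z : Cx) : Cx :=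
  Cmul (Cdiv (RtoC (sqrt (CIm (a n)))) (Csub z (Cconj (a n)))) (Bplus a n z).

Definition Bminus (a : nat -> Cx) (n : nat) (z : Cx) : Cx :=
  Cprod (Nat.pred n) (fun j => Bfac (bseq a (S j)) z).
Definition Phiminus (a : nat -> Cx) (n : nat) (z : Cx) : Cx :=
  Cmul (Cdiv (RtoC (sqrt (- CIm (bseq a n)))) (Csub z (Cconj (bseq a n))))
       (Bminus a n z).

Definition Phi (a : nat -> Cx) (k : Z) (z : Cx) : Cx :=
  if (0 <=? k)%Z then Phiplus a (Z.to_nat k) z else Phiminus a (Z.to_nat (- k)) z.

Definition ImpInt (g : R -> R) (l : R) : Prop :=
  (forall a b : R, exists _ : Riemann_integrable g a b, True) /\
  (forall eps : R, 0 < eps -> exists M : R, 0 < M /\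
     forall a b : R, a <= - M -> M <= b ->
       forall pr : Riemann_integrable g a b, Rabs (RiemannInt pr - l) < eps).

Definition CImpInt (g : R -> Cx) (l : Cx) : Prop :=
  ImpInt (fun t => fst (g t)) (fst l) /\ ImpInt (fun t => snd (g t)) (snd l).

(* f in L_1(R) (f locally Riemann integrable, |f| improperly integrable) *)
Definition L1 (f : R -> Cx) : Prop :=
  (exists l : Cx, CImpInt f l) /\ (exists l : R, ImpInt (fun t => Cmod (f t)) l).

Definition BV (f : R -> Cx) : Prop :=
  exists V : R, forall (n : nat) (x : nat -> R),
    (forall i, (i < n)%nat -> x i <= x (S i)) ->
    Rsum n (fun i => Cmod (Csub (f (x (S i))) (f (x i)))) <= V.

Definition IsCoef (f : R -> Cx) (a : nat -> Cx) (k : Z) (c : Cx) : Prop :=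
  exists I : Cx, CImpInt (fun t => Cmul (f t) (Cconj (Phi a k (RtoC t)))) I
                /\ c = Cscale (/ PI) I.

Definition Spart (a : nat -> Cx) (c : Z -> Cx) (n : nat) (x : R) : Cx :=
  Csum (2 * n) (fun j => let k := (Z.of_nat j - Z.of_nat n)%Z in
                         Cmul (c k) (Phi a k (RtoC x))).

Definition sigmaA (a : nat -> Cx) (n : nat) : R :=
  Rsum n (fun k => Rabs (CIm (a k)) / (1 + Cnorm2 (a k))).
Definition varsigmaA (a : nat -> Cx) (n : nat) : R :=
  Rsum n (fun k => 1 / (CIm (a k) * CIm (a k))).

Definition no_real_limit_points (a : nat -> Cx) : Prop :=
  ~ exists (phi : nat -> nat) (x : R),
      (forall k, (phi k < phi (S k))%nat) /\
      (forall eps, 0 < eps -> exists N, forall k, (N <= k)%nat ->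
          Cmod (Csub (a (phi k)) (RtoC x)) < eps).

Definition Ccv (u : nat -> Cx) (l : Cx) : Prop :=
  forall eps, 0 < eps -> exists N, forall n, (N <= n)%nat -> Cmod (Csub (u n) l) < eps.

Definition right_limit (f : R -> Cx) (x0 : R) (L : Cx) : Prop :=
  forall eps, 0 < eps -> exists d, 0 < d /\
    forall x, x0 < x < x0 + d -> Cmod (Csub (f x) L) < eps.
Definition left_limit (f : R -> Cx) (x0 : R) (L : Cx) : Prop :=
  forall eps, 0 < eps -> exists d, 0 < d /\
    forall x, x0 - d < x < x0 -> Cmod (Csub (f x) L) < eps.

(* Main.v *)
(* On the real axis |B_n| = 1, so the partial sum is (1/pi) times the integral of f against the
   kernel sin(phi_n(s)) / s with s = t - x0, where exp(i phi_n(s)) = B_n(x0 + s) / B_n(x0).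
   The phase satisfies phi_n' >= c sigma_n and |phi_n''| <= 2 varsigma_n <= L phi_n' on [-T, T]
   with c > 0 and L independent of n.  Hence s phi_n'(s) - phi_n(s) is at most L s phi_n(s), and
   the integral of the kernel over [0, s] differs from Si(phi_n(s)) by at most L s; away from
   s = 0 an integration by parts gives O(1 / sigma_n).  With Si(+oo) = pi/2 the convergence then
   follows as in the Dirichlet-Jordan theorem, and the tails |s| > T are O(1/T) since f is in L_1. *)

From Stdlib Require Import Reals ZArith Lra Lia.
From Coquelicot Require Import Rcomplements Rbar Hierarchy Continuity Derive ElemFct RInt
  RInt_analysis AutoDerive.
Require Import Defs.
Open Scope R_scope.

(** * Riemann integrals *)

(** The order of choices shapes the proof: the cut-off [T] is fixed by the tails, then a small [d]
    by the one-sided limit, and only then is [n] taken large. Every estimate near [s = 0] must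
    therefore be uniform in [n]. The bound on [varsigma_n / sigma_n] serves this purpose: it
    controls the curvature of the phase by its slope, so that the error of a linear phase does not
    grow with [n]. The absolute integral of the kernel near [0] has no bound uniform in [n]; only
    its primitives do. Hence the deviation of [f] from its one-sided limit is treated by Abel
    summation against a function [W] dominating the increments of both [Re f] and [Im f]. The kernel
    is real, so the two parts separate. Integrations by parts appear as derivative bounds for a
    primitive plus a boundary term, which spares any integrability of the differentiated factors.
    Existence of the coefficients and of the one-sided limits belongs to the conclusion and is
    derived as well. *)

Lemma ex_RInt_Lipschitz_comp (psi f : R -> R) (K a b : R) :
  0 < K -> (forall x y, Rabs (psi x - psi y) <= K * Rabs (x - y)) ->
  ex_RInt f a b -> ex_RInt (fun t => psi (f t)) a b.
Proof.
intros HK Hpsi Hf; apply ex_RInt_Reals_1.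
apply ex_RInt_Reals_0 in Hf; intros eps.
assert (He : 0 < eps / K) by (apply Rdiv_lt_0_compat; [apply cond_pos | assumption]).
destruct (Hf (mkposreal _ He)) as [phi [rho [H1 H2]]].
(* [psi] turns the step function [phi] into one on the same subdivision and enlarges the error bound
   [rho] at most by the factor [K]; hence the tolerance [eps / K]. *)
assert (Hstep : IsStepFun (fun t => psi (phi t)) a b).
{ destruct (pre phi) as [l [lf [A1 [A2 [A3 [A4 A5]]]]]].
  exists l, (List.map psi lf); unfold adapted_couple.
  repeat split; try assumption.
  - now rewrite List.length_map.
  - intros i Hi t Ht.
    rewrite (A5 i Hi t Ht); symmetry.
    rewrite RList.RList_P12; [reflexivity | lia]. }
exists (mkStepFun Hstep).
set (z := mkStepFun (StepFun_P4 a b 0)).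
exists (mkStepFun (StepFun_P28 K z rho)); split.
- intros t Ht; simpl; unfold fct_cte.
  rewrite Rplus_0_l; apply Rle_trans with (1 := Hpsi _ _).
  apply Rmult_le_compat_l; [lra | exact (H1 t Ht)].
- rewrite StepFun_P30; unfold z; rewrite StepFun_P18.
  replace (0 * (b - a) + K * RiemannInt_SF rho) with (K * RiemannInt_SF rho) by ring.
  rewrite Rabs_mult, (Rabs_pos_eq K) by lra.
  simpl in H2; apply (Rmult_lt_compat_l K) in H2; [|assumption].
  replace (K * (eps / K)) with (pos eps) in H2 by (field; lra); exact H2.
Qed.

Lemma ex_RInt_bounded (f : R -> R) (a b : R) :
  ex_RInt f a b ->
  exists M, 0 < M /\ forall t, Rmin a b <= t <= Rmax a b -> Rabs (f t) <= M.
Proof.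
intros Hf; destruct (ex_RInt_ub f a b Hf) as [M HM].
exists (Rabs M + 1); split; [pose proof (Rabs_pos M); lra|].
intros t Ht; specialize (HM t Ht); change (Rabs (f t) <= M) in HM.
pose proof (Rle_abs M); lra.
Qed.

(** Squaring is Lipschitz only on bounded sets. Clamping to [[-M, M]] first makes it Lipschitz
    everywhere and changes nothing for a function bounded by [M]. *)
Lemma clamp_sqr_Lipschitz (M x y : R) : 0 < M ->
  Rabs ((Rmax (- M) (Rmin M x)) ^ 2 - (Rmax (- M) (Rmin M y)) ^ 2)
    <= (2 * M) * Rabs (x - y).
Proof.
intros HM.
set (p := Rmax (- M) (Rmin M x)); set (q := Rmax (- M) (Rmin M y)).
assert (Hp : Rabs p <= M).
{ apply Rabs_le; unfold p, Rmax, Rmin; repeat destruct Rle_dec; lra. }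
assert (Hq : Rabs q <= M).
{ apply Rabs_le; unfold q, Rmax, Rmin; repeat destruct Rle_dec; lra. }
assert (Hpq : Rabs (p - q) <= Rabs (x - y)).
{ unfold p, q, Rmax, Rmin, Rabs; repeat destruct Rle_dec;
  repeat destruct Rcase_abs; lra. }
replace (p ^ 2 - q ^ 2) with ((p + q) * (p - q)) by ring.
rewrite Rabs_mult.
apply Rmult_le_compat; try apply Rabs_pos; [|assumption].
apply Rle_trans with (1 := Rabs_triang _ _); lra.
Qed.

Lemma ex_RInt_sqr (f : R -> R) (a b : R) :
  ex_RInt f a b -> ex_RInt (fun t => f t ^ 2) a b.
Proof.
intros Hf; destruct (ex_RInt_bounded f a b Hf) as [M [HM HfM]].
apply ex_RInt_ext with (fun t => (Rmax (- M) (Rmin M (f t))) ^ 2).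
- intros t Ht; assert (Ht' : Rmin a b <= t <= Rmax a b) by lra.
  apply HfM, Rabs_le_between in Ht'.
  rewrite Rmin_right, Rmax_right; [reflexivity | lra | lra].
- apply (ex_RInt_Lipschitz_comp (fun y => (Rmax (- M) (Rmin M y)) ^ 2) f (2 * M));
    [lra | | assumption].
  intros x y; now apply clamp_sqr_Lipschitz.
Qed.

(** Polarisation, [f g = ((f + g)^2 - f^2 - g^2) / 2], reduces products to squares. *)
Lemma ex_RInt_mult (f g : R -> R) (a b : R) :
  ex_RInt f a b -> ex_RInt g a b -> ex_RInt (fun t => f t * g t) a b.
Proof.
intros Hf Hg.
apply ex_RInt_ext with
  (fun t => plus (scal (/ 2) ((f t + g t) ^ 2))
              (opp (scal (/ 2) (plus (f t ^ 2) (g t ^ 2))))).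
- intros t _; unfold plus, scal, opp; simpl; unfold mult; simpl; field.
- apply (ex_RInt_plus (V := R_NormedModule)).
  + apply (ex_RInt_scal (V := R_NormedModule)), ex_RInt_sqr.
    now apply (ex_RInt_plus (V := R_NormedModule)).
  + apply (ex_RInt_opp (V := R_NormedModule)).
    apply (ex_RInt_scal (V := R_NormedModule)).
    now apply (ex_RInt_plus (V := R_NormedModule)); apply ex_RInt_sqr.
Qed.

Lemma RInt_split (f : R -> R) (a b c : R) :
  (forall x y, ex_RInt f x y) -> RInt f a b = RInt f a c + RInt f c b.
Proof. intros H; symmetry; now apply (RInt_Chasles (V := R_CompleteNormedModule)). Qed.

Lemma RInt_comb (f g : R -> R) (c d a b : R) :
  ex_RInt f a b -> ex_RInt g a b ->
  RInt (fun t => c * f t + d * g t) a b = c * RInt f a b + d * RInt g a b.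
Proof.
intros Hf Hg; apply (is_RInt_unique (V := R_CompleteNormedModule)).
apply (is_RInt_plus (V := R_NormedModule));
  apply (is_RInt_scal (V := R_NormedModule)); now apply (RInt_correct (V := R_CompleteNormedModule)).
Qed.

Lemma ex_RInt_comb (f g : R -> R) (c d a b : R) :
  ex_RInt f a b -> ex_RInt g a b -> ex_RInt (fun t => c * f t + d * g t) a b.
Proof.
intros Hf Hg.
apply (ex_RInt_plus (V := R_NormedModule));
  now apply (ex_RInt_scal (V := R_NormedModule)).
Qed.

Lemma Rabs_RInt_le (f h : R -> R) (a b : R) : a <= b ->
  ex_RInt f a b -> ex_RInt h a b -> (forall t, a <= t <= b -> Rabs (f t) <= h t) ->
  Rabs (RInt f a b) <= RInt h a b.
Proof.
intros Hab Hf Hh H.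
apply (norm_RInt_le (V := R_NormedModule) f h a b); trivial;
  now apply (RInt_correct (V := R_CompleteNormedModule)).
Qed.

(** * Improper integrals over the real line *)

Lemma ImpInt_ex (g : R -> R) (l a b : R) : ImpInt g l -> ex_RInt g a b.
Proof. intros [H _]; destruct (H a b) as [pr _]; now apply ex_RInt_Reals_1. Qed.

Lemma ImpInt_lim (g : R -> R) (l eps : R) : ImpInt g l -> 0 < eps ->
  exists M, 0 < M /\ forall a b, a <= - M -> M <= b -> Rabs (RInt g a b - l) < eps.
Proof.
intros Hg He; destruct (proj2 Hg eps He) as [M [HM H]].
exists M; split; [assumption|]; intros a b Ha Hb.
rewrite (RInt_Reals g a b (ex_RInt_Reals_0 _ _ _ (ImpInt_ex g l a b Hg))).
now apply H.
Qed.

Lemma ImpInt_intro (g : R -> R) (l : R) : (forall a b, ex_RInt g a b) ->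
  (forall eps, 0 < eps -> exists M, 0 < M /\
     forall a b, a <= - M -> M <= b -> Rabs (RInt g a b - l) < eps) ->
  ImpInt g l.
Proof.
intros Hex H; split.
- intros a b; now exists (ex_RInt_Reals_0 _ _ _ (Hex a b)).
- intros eps He; destruct (H eps He) as [M [HM HH]].
  exists M; split; [assumption|]; intros a b Ha Hb pr.
  rewrite <- RInt_Reals; now apply HH.
Qed.

Lemma ImpInt_comb (f g : R -> R) (l m c d : R) : ImpInt f l -> ImpInt g m ->
  ImpInt (fun t => c * f t + d * g t) (c * l + d * m).
Proof.
intros Hf Hg; apply ImpInt_intro.
- intros a b; apply ex_RInt_comb; eapply ImpInt_ex; eassumption.
- intros eps He.
  assert (Hc : 0 < Rabs c + 1) by (pose proof (Rabs_pos c); lra).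
  assert (Hd : 0 < Rabs d + 1) by (pose proof (Rabs_pos d); lra).
  destruct (ImpInt_lim f l (eps / (2 * (Rabs c + 1))) Hf) as [M [HM H1]].
  { apply Rdiv_lt_0_compat; lra. }
  destruct (ImpInt_lim g m (eps / (2 * (Rabs d + 1))) Hg) as [N [HN H2]].
  { apply Rdiv_lt_0_compat; lra. }
  exists (M + N); split; [lra|]; intros a b Ha Hb.
  rewrite RInt_comb; [|eapply ImpInt_ex; eassumption..].
  specialize (H1 a b ltac:(lra) ltac:(lra)); specialize (H2 a b ltac:(lra) ltac:(lra)).
  replace (c * RInt f a b + d * RInt g a b - (c * l + d * m))
    with (c * (RInt f a b - l) + d * (RInt g a b - m)) by ring.
  apply Rle_lt_trans with (1 := Rabs_triang _ _); rewrite !Rabs_mult.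
  assert (E1 : (Rabs c + 1) * Rabs (RInt f a b - l) < eps / 2).
  { apply Rlt_le_trans with ((Rabs c + 1) * (eps / (2 * (Rabs c + 1)))).
    - now apply Rmult_lt_compat_l.
    - right; field; lra. }
  assert (E2 : (Rabs d + 1) * Rabs (RInt g a b - m) < eps / 2).
  { apply Rlt_le_trans with ((Rabs d + 1) * (eps / (2 * (Rabs d + 1)))).
    - now apply Rmult_lt_compat_l.
    - right; field; lra. }
  pose proof (Rabs_pos (RInt f a b - l)); pose proof (Rabs_pos (RInt g a b - m)); lra.
Qed.

Lemma ImpInt_ext (f g : R -> R) (l : R) : (forall t, f t = g t) -> ImpInt f l -> ImpInt g l.
Proof.
intros E Hf; apply ImpInt_intro.
- intros a b; apply ex_RInt_ext with f; [intros t _; apply E | eapply ImpInt_ex; eassumption].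
- intros eps He; destruct (ImpInt_lim f l eps Hf He) as [M [HM H]].
  exists M; split; [assumption|]; intros a b Ha Hb.
  rewrite (RInt_ext g f); [now apply H | intros; symmetry; apply E].
Qed.

Lemma ImpInt_RInt_le (h : R -> R) (l a b : R) : ImpInt h l -> (forall t, 0 <= h t) ->
  a <= b -> RInt h a b <= l.
Proof.
intros Hh Hp Hab; apply le_epsilon; intros eps He.
destruct (ImpInt_lim h l eps Hh He) as [M [HM H]].
set (u := Rmin a (- M)); set (v := Rmax b M).
assert (Hu : u <= a) by apply Rmin_l; assert (Hv : b <= v) by apply Rmax_l.
specialize (H u v (Rmin_r _ _) (Rmax_r _ _)); apply Rabs_lt_between in H.
assert (Hex : forall x y, ex_RInt h x y) by (intros; eapply ImpInt_ex; eassumption).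
rewrite (RInt_split h u v a Hex), (RInt_split h a v b Hex) in H.
pose proof (RInt_ge_0 h u a Hu (Hex _ _) (fun t _ => Hp t)).
pose proof (RInt_ge_0 h b v Hv (Hex _ _) (fun t _ => Hp t)); lra.
Qed.

(** Cauchy criterion: enlarging [[-M, M]] changes the integral of [h] by less than [eps / 2], hence
    that of [g] too, and completeness along the intervals [[-n, n]] supplies the limit. *)
Lemma ImpInt_dominated (g h : R -> R) (l : R) : (forall a b, ex_RInt g a b) ->
  ImpInt h l -> (forall t, Rabs (g t) <= h t) -> exists m, ImpInt g m.
Proof.
intros Hex Hh Hgh.
assert (Hp : forall t, 0 <= h t) by (intros t; apply Rle_trans with (2 := Hgh t), Rabs_pos).
assert (Hhex : forall x y, ex_RInt h x y) by (intros; eapply ImpInt_ex; eassumption).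
assert (Hle : forall a b, a <= b -> Rabs (RInt g a b) <= RInt h a b)
  by (intros; apply Rabs_RInt_le; auto).
assert (Htail : forall eps, 0 < eps -> exists M, 0 < M /\
  forall a b u v, a <= - M -> M <= b -> u <= - M -> M <= v ->
    Rabs (RInt g a b - RInt g u v) < eps).
{ intros eps He; destruct (ImpInt_lim h l (eps / 4) Hh) as [M [HM H]]; [lra|].
  exists M; split; [assumption|].
  assert (HH : forall a b, a <= - M -> M <= b ->
            Rabs (RInt g a b - RInt g (- M) M) < eps / 2).
  { intros a b Ha Hb.
    rewrite (RInt_split g a b (- M) Hex), (RInt_split g (- M) b M Hex).
    pose proof (H a b Ha Hb) as H1; pose proof (H (- M) M (Rle_refl _) (Rle_refl _)) as H2.
    rewrite (RInt_split h a b (- M) Hhex), (RInt_split h (- M) b M Hhex) in H1.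
    pose proof (Hle a (- M) Ha) as H3; pose proof (Hle M b Hb) as H4.
    apply Rabs_lt_between in H1, H2; apply Rabs_le_between in H3, H4.
    apply Rabs_lt_between; lra. }
  intros a b u v Ha Hb Hu Hv.
  pose proof (HH a b Ha Hb) as H1; pose proof (HH u v Hu Hv) as H2.
  apply Rabs_lt_between in H1, H2; apply Rabs_lt_between; lra. }
destruct (Rcomplete.R_complete (fun n => RInt g (- INR n) (INR n))) as [m Hm].
{ intros eps He; destruct (Htail eps He) as [M [HM H]].
  destruct (INR_unbounded M) as [N HN]; exists N; intros n p Hn Hp'.
  apply le_INR in Hn, Hp'; apply H; lra. }
exists m; apply ImpInt_intro; [assumption|].
intros eps He; destruct (Htail (eps / 2)) as [M [HM H]]; [lra|].
exists M; split; [assumption|]; intros a b Ha Hb.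
destruct (Hm (eps / 2)) as [N HN]; [lra|].
destruct (INR_unbounded M) as [N' HN'].
specialize (HN (max N N') ltac:(lia)); unfold Rdist in HN.
assert (HB : M <= INR (max N N')).
{ apply Rle_trans with (INR N'); [lra | apply le_INR; lia]. }
specialize (H a b (- INR (max N N')) (INR (max N N')) Ha Hb ltac:(lra) HB).
apply Rabs_lt_between in H, HN; apply Rabs_lt_between; lra.
Qed.

(** * The sine integral *)

Lemma increment_le (f g df dg : R -> R) (a b : R) : a <= b ->
  (forall x, a < x < b -> is_derive f x (df x)) ->
  (forall x, a < x < b -> is_derive g x (dg x)) ->
  (forall x, a <= x <= b -> continuity_pt f x) ->
  (forall x, a <= x <= b -> continuity_pt g x) ->
  (forall x, a < x < b -> df x <= dg x) -> f b - f a <= g b - g a.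
Proof.
intros Hab Hf Hg Cf Cg Hle.
(* The mean value point may be an endpoint, where nothing is assumed about [df] and [dg]; the
   default [0] keeps [0 <= dh c] true there. *)
set (dh := fun x => if Rlt_dec a x then if Rlt_dec x b then dg x - df x else 0 else 0).
destruct (MVT_gen (fun x => g x - f x) a b dh) as [c [_ Hc]].
- rewrite Rmin_left, Rmax_right by assumption; intros x Hx; unfold dh.
  destruct Rlt_dec; [destruct Rlt_dec; [|lra] | lra].
  apply (is_derive_minus (V := R_NormedModule)); auto.
- rewrite Rmin_left, Rmax_right by assumption; intros x Hx.
  apply continuity_pt_minus; auto.
- assert (0 <= dh c).
  { unfold dh; destruct Rlt_dec; [destruct Rlt_dec; [|lra] | lra].
    specialize (Hle c ltac:(lra)); lra. }
  assert (0 <= dh c * (b - a)) by (apply Rmult_le_pos; lra); lra.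
Qed.

(** Takes the place of bounding an integral of [df] by an integral of [dg]; neither derivative has
    to be integrable. *)
Lemma increment_Rabs_le (f g df dg : R -> R) (a b : R) : a <= b ->
  (forall x, a < x < b -> is_derive f x (df x)) ->
  (forall x, a < x < b -> is_derive g x (dg x)) ->
  (forall x, a <= x <= b -> continuity_pt f x) ->
  (forall x, a <= x <= b -> continuity_pt g x) ->
  (forall x, a < x < b -> Rabs (df x) <= dg x) -> Rabs (f b - f a) <= g b - g a.
Proof.
intros Hab Hf Hg Cf Cg Hle; apply Rabs_le; split.
- assert (H : - g b - - g a <= f b - f a); [|lra].
  apply (increment_le (fun x => - g x) f (fun x => - dg x) df); trivial.
  + intros x Hx; apply (is_derive_opp (V := R_NormedModule)); auto.
  + intros x Hx; apply continuity_pt_opp; auto.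
  + intros x Hx; specialize (Hle x Hx); apply Rabs_le_between in Hle; lra.
- apply (increment_le f g df dg); trivial.
  intros x Hx; specialize (Hle x Hx); apply Rabs_le_between in Hle; lra.
Qed.

Lemma increment_Lipschitz (f df : R -> R) (K a b : R) : a <= b ->
  (forall x, a < x < b -> is_derive f x (df x)) ->
  (forall x, a <= x <= b -> continuity_pt f x) ->
  (forall x, a < x < b -> Rabs (df x) <= K) -> Rabs (f b - f a) <= K * (b - a).
Proof.
intros Hab Hf Cf HK; replace (K * (b - a)) with (K * b - K * a) by ring.
apply (increment_Rabs_le f (fun x => K * x) df (fun _ => K)); trivial.
- intros x _; auto_derive; [trivial | ring].
- intros x _; apply continuity_pt_mult; [apply continuity_pt_const; now intros ? ? |].
  apply derivable_continuous_pt, derivable_pt_id.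
Qed.

Lemma is_derive_continuity_pt (f : R -> R) (x l : R) : is_derive f x l -> continuity_pt f x.
Proof.
intros H; apply derivable_continuous_pt; exists l; now apply is_derive_Reals.
Qed.

Lemma is_derive_mul (f g : R -> R) (x df dg : R) : is_derive f x df -> is_derive g x dg ->
  is_derive (fun t => f t * g t) x (df * g x + f x * dg).
Proof.
intros Hf Hg; apply is_derive_Reals in Hf, Hg; apply is_derive_Reals.
exact (derivable_pt_lim_mult f g x df dg Hf Hg).
Qed.

Lemma continuity_ex_RInt (f : R -> R) (a b : R) : continuity f -> ex_RInt f a b.
Proof.
intros H; apply (ex_RInt_continuous (V := R_CompleteNormedModule)).
intros z _; apply continuity_pt_filterlim, H.
Qed.

Lemma is_derive_primitive (f : R -> R) (a x : R) : continuity f ->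
  is_derive (fun y => RInt f a y) x (f x).
Proof.
intros H; apply (is_derive_RInt (V := R_NormedModule) f (fun y => RInt f a y) a).
- apply filter_forall; intros y.
  apply (RInt_correct (V := R_CompleteNormedModule)); now apply continuity_ex_RInt.
- apply continuity_pt_filterlim, H.
Qed.

Definition sinc (t : R) : R := if Req_EM_T t 0 then 1 else sin t / t.

Lemma sinc_neq0 (t : R) : t <> 0 -> sinc t = sin t / t.
Proof. intros H; unfold sinc; destruct Req_EM_T; [contradiction | reflexivity]. Qed.

Lemma continuity_sinc : continuity sinc.
Proof.
intros x; destruct (Req_dec x 0) as [->|Hx].
- apply continuity_pt_filterlim'.
  unfold sinc at 2; destruct Req_EM_T; [|lra].
  change (is_lim sinc 0 1).
  apply is_lim_ext_loc with (fun t => sin t / t); [|apply is_lim_sinc_0].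
  exists (mkposreal 1 Rlt_0_1); intros y _ Hy; now rewrite sinc_neq0.
- apply continuity_pt_ext_loc with (fun t => sin t / t).
  + exists (mkposreal _ (Rabs_pos_lt x Hx)); intros y Hy.
    symmetry; apply sinc_neq0; intros ->.
    change (Rabs (0 - x) < Rabs x) in Hy; rewrite Rminus_0_l, Rabs_Ropp in Hy; lra.
  + apply (is_derive_continuity_pt _ _ ((cos x * x - sin x) / (x * x))).
    auto_derive; [assumption | field; assumption].
Qed.

Definition Si (x : R) : R := RInt sinc 0 x.

Lemma Si_0 : Si 0 = 0.
Proof. unfold Si; apply (RInt_point (V := R_CompleteNormedModule)). Qed.

Lemma is_derive_Si (x : R) : is_derive Si x (sinc x).
Proof. apply is_derive_primitive, continuity_sinc. Qed.

Lemma sin_lower_cubic (u : R) : 0 <= u <= 1 -> u - u ^ 3 / 6 <= sin u.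
Proof.
intros Hu; destruct (sin_bound u 0 ltac:(lra)) as [H _].
- pose proof PI2_1; lra.
- unfold sin_approx, sin_term, sum_f_R0 in H; simpl in H; lra.
Qed.

(** In [(u - sin u) / (u * sin u)] the numerator is at most [u^3 / 6] and the denominator at least
    [5 u^2 / 6]. *)
Lemma Rabs_inv_sin_minus_inv (u : R) : 0 < u <= 1 -> Rabs (/ sin u - / u) <= 1.
Proof.
intros Hu.
pose proof (sin_lower_cubic u ltac:(lra)) as H1.
assert (H2 : sin u < u) by (apply sin_lt_x; lra).
assert (Hu3 : u ^ 3 <= u ^ 2) by nra.
assert (Hs : 0 < sin u) by nra.
replace (/ sin u - / u) with ((u - sin u) / (u * sin u)) by (field; lra).
rewrite Rabs_pos_eq.
- apply Rle_div_l; [nra|]; rewrite Rmult_1_l.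
  assert (u * (u - u ^ 3 / 6) <= u * sin u) by (apply Rmult_le_compat_l; lra).
  assert (u ^ 4 <= u ^ 2) by nra.
  simpl in *; nra.
- apply Rle_div_r; nra.
Qed.

(** The Dirichlet kernel [sin ((2 N + 1) u) / sin u] in the doubled angle. The cosine form makes
    sense at [u = 0] and has an explicit primitive whose sine terms vanish at [0] and [PI / 2]. *)
Definition dirichlet (N : nat) (u : R) : R :=
  1 + Rsum N (fun k => 2 * cos (2 * INR (S k) * u)).
Definition dirichlet_primitive (N : nat) (u : R) : R :=
  u + Rsum N (fun k => sin (2 * INR (S k) * u) / INR (S k)).

Lemma is_derive_dirichlet_primitive (N : nat) (u : R) :
  is_derive (dirichlet_primitive N) u (dirichlet N u).
Proof.
unfold dirichlet_primitive, dirichlet.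
apply (is_derive_plus (V := R_NormedModule) (fun u => u)); [apply (is_derive_id (K := R_AbsRing))|].
induction N as [|N IH]; cbn [Rsum].
- apply (is_derive_const (V := R_NormedModule)).
- apply (is_derive_plus (V := R_NormedModule)
    (fun u => Rsum N (fun k => sin (2 * INR (S k) * u) / INR (S k)))); [exact IH|].
  assert (Hm : INR (S N) <> 0) by (apply not_0_INR; lia); generalize dependent (INR (S N)).
  intros m Hm; auto_derive; [trivial | now field].
Qed.

Lemma sin_mul_dirichlet (N : nat) (u : R) :
  sin u * dirichlet N u = sin ((2 * INR N + 1) * u).
Proof.
induction N as [|N IH].
- unfold dirichlet; cbn [Rsum]; simpl INR; replace ((2 * 0 + 1) * u) with u by ring; ring.
- unfold dirichlet in *; cbn [Rsum].
  replace (sin u * (1 + (Rsum N (fun k => 2 * cos (2 * INR (S k) * u))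
             + 2 * cos (2 * INR (S N) * u))))
    with (sin ((2 * INR N + 1) * u) + 2 * sin u * cos (2 * INR (S N) * u))
    by (rewrite <- IH; ring).
  rewrite S_INR.
  replace ((2 * INR N + 1) * u) with (2 * (INR N + 1) * u - u) by ring.
  replace ((2 * (INR N + 1) + 1) * u) with (2 * (INR N + 1) * u + u) by ring.
  rewrite sin_minus, sin_plus; ring.
Qed.

Lemma dirichlet_primitive_PI2 (N : nat) : dirichlet_primitive N (PI / 2) = PI / 2.
Proof.
unfold dirichlet_primitive; cut (Rsum N (fun k => sin (2 * INR (S k) * (PI / 2)) / INR (S k)) = 0).
{ intros ->; ring. }
induction N as [|N IH]; cbn [Rsum]; [reflexivity|]; rewrite IH.
replace (2 * INR (S N) * (PI / 2)) with (IZR (Z.of_nat (S N)) * PI)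
  by (rewrite <- INR_IZR_INZ; field).
rewrite sin_eq_0_1 by now exists (Z.of_nat (S N)).
unfold Rdiv; ring.
Qed.

Lemma dirichlet_primitive_0 (N : nat) : dirichlet_primitive N 0 = 0.
Proof.
unfold dirichlet_primitive; rewrite Rplus_0_l.
induction N as [|N IH]; cbn [Rsum]; [reflexivity|].
rewrite IH, Rmult_0_r, sin_0; unfold Rdiv; ring.
Qed.

(* Compares the Dirichlet kernel [sin (nu u) / sin u], whose integral over [0, PI/2] is
   known, with [sin (nu u) / u]; away from [0] one integrates by parts. *)
Lemma Si_dirichlet (N : nat) (d : R) : 0 < d <= 1 ->
  Rabs (Si ((2 * INR N + 1) * (PI / 2)) - PI / 2)
    <= d + (2 * (/ sin d + / d) + 2 * (/ (sin d) ^ 2 + / d ^ 2)) / (2 * INR N + 1).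
Proof.
intros Hd; set (nu := 2 * INR N + 1).
assert (Hnu : 0 < nu) by (unfold nu; pose proof (pos_INR N); lra).
pose proof PI2_1 as HPI; pose proof PI_4 as HPI4.
(* The increment of [G] over [[0, PI / 2]] is exactly [PI / 2 - Si (nu * (PI / 2))]. *)
set (G := fun u => dirichlet_primitive N u - Si (nu * u)).
assert (HG : forall u, is_derive G u (dirichlet N u - nu * sinc (nu * u))).
{ intros u; apply (is_derive_minus (V := R_NormedModule));
    [apply is_derive_dirichlet_primitive|].
  apply (is_derive_comp (V := R_NormedModule) Si (fun u => nu * u)); [apply is_derive_Si|].
  auto_derive; [trivial | ring]. }
assert (HG' : forall u, 0 < u -> 0 < sin u ->
  dirichlet N u - nu * sinc (nu * u) = sin (nu * u) * (/ sin u - / u)).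
{ intros u Hu Hs; rewrite sinc_neq0 by (apply Rgt_not_eq; now apply Rmult_lt_0_compat).
  unfold nu at 2 4; rewrite <- sin_mul_dirichlet; field; lra. }
assert (CG : forall u, continuity_pt G u) by (intros u; eapply is_derive_continuity_pt, HG).
assert (Hsin : forall u, d <= u <= PI / 2 -> sin d <= sin u)
  by (intros u Hu; apply sin_incr_1; lra).
assert (Hsd : 0 < sin d) by (apply sin_gt_0; lra).
assert (H1 : Rabs (G d - G 0) <= 1 * (d - 0)).
{ apply (increment_Lipschitz G (fun u => dirichlet N u - nu * sinc (nu * u))); [lra|auto|auto|].
  intros u Hu; rewrite HG'; [|lra|apply sin_gt_0; lra].
  rewrite Rabs_mult, <- (Rmult_1_r 1).
  apply Rmult_le_compat; try apply Rabs_pos.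
  - apply Rabs_le, SIN_bound.
  - apply Rabs_inv_sin_minus_inv; lra. }
(* The derivative of [G] is [nu * sin (nu * u) * w u]. Adding [cos (nu * u) * w u] cancels it and
   leaves [cos (nu * u)] times the derivative of [w], which is of order [1 / nu] away from [0]. *)
set (w := fun u => (/ sin u - / u) / nu).
set (Q := fun u => G u + cos (nu * u) * w u).
set (B := / (sin d) ^ 2 + / d ^ 2).
assert (HQ : forall u, 0 < u -> 0 < sin u ->
   is_derive Q u (cos (nu * u) * ((- cos u / (sin u) ^ 2 + / u ^ 2) / nu))).
{ intros u Hu Hs.
  evar_last.
  - apply (is_derive_plus (V := R_NormedModule)); [apply HG|].
    unfold w; auto_derive; [|reflexivity]; repeat split; lra.
  - unfold plus; simpl; rewrite HG' by assumption; field; repeat split; lra. }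
assert (H2 : Rabs (Q (PI / 2) - Q d) <= B / nu * (PI / 2 - d)).
{ apply (increment_Lipschitz Q
     (fun u => cos (nu * u) * ((- cos u / (sin u) ^ 2 + / u ^ 2) / nu))); [lra| | |].
  - intros u Hu; apply HQ; [lra|apply sin_gt_0; lra].
  - intros u Hu; eapply is_derive_continuity_pt, HQ; [lra|apply sin_gt_0; lra].
  - intros u Hu; specialize (Hsin u ltac:(lra)).
    rewrite Rabs_mult, <- (Rmult_1_l (B / nu)).
    apply Rmult_le_compat; try apply Rabs_pos; [apply Rabs_le, COS_bound|].
    unfold Rdiv; rewrite Rabs_mult, (Rabs_pos_eq (/ nu)) by (left; now apply Rinv_0_lt_compat).
    apply Rmult_le_compat_r; [left; now apply Rinv_0_lt_compat|].
    apply Rle_trans with (1 := Rabs_triang _ _); unfold B.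
    apply Rplus_le_compat.
    + rewrite Rabs_mult, Rabs_Ropp, (Rabs_pos_eq (/ sin u ^ 2))
        by (left; apply Rinv_0_lt_compat, pow_lt; lra).
      rewrite <- (Rmult_1_l (/ sin d ^ 2)); apply Rmult_le_compat.
      * apply Rabs_pos.
      * left; apply Rinv_0_lt_compat, pow_lt; lra.
      * apply Rabs_le, COS_bound.
      * apply Rinv_le_contravar; [now apply pow_lt | apply pow_incr; lra].
    + rewrite Rabs_pos_eq by (left; apply Rinv_0_lt_compat, pow_lt; lra).
      apply Rinv_le_contravar; [apply pow_lt; lra | apply pow_incr; lra]. }
assert (Hw : forall u, d <= u <= PI / 2 -> Rabs (cos (nu * u) * w u) <= (/ sin d + / d) / nu).
{ intros u Hu; specialize (Hsin u ltac:(lra)); unfold w, Rdiv.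
  rewrite <- Rmult_assoc, Rabs_mult, (Rabs_pos_eq (/ nu)) by (left; now apply Rinv_0_lt_compat).
  apply Rmult_le_compat_r; [left; now apply Rinv_0_lt_compat|].
  rewrite Rabs_mult, <- (Rmult_1_l (/ sin d + / d)).
  apply Rmult_le_compat; try apply Rabs_pos; [apply Rabs_le, COS_bound|].
  assert (0 < / sin u <= / sin d)
    by (split; [apply Rinv_0_lt_compat | apply Rinv_le_contravar]; lra).
  assert (0 < / u <= / d)
    by (split; [apply Rinv_0_lt_compat | apply Rinv_le_contravar]; lra).
  apply Rabs_le; lra. }
pose proof (Hw d ltac:(lra)) as W1; pose proof (Hw (PI / 2) ltac:(lra)) as W2.
assert (HB : 0 < B).
{ unfold B; apply Rplus_lt_0_compat; apply Rinv_0_lt_compat, pow_lt; lra. }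
assert (H3 : B / nu * (PI / 2 - d) <= B / nu * 2).
{ apply Rmult_le_compat_l; [left; now apply Rdiv_lt_0_compat | lra]. }
replace ((2 * (/ sin d + / d) + 2 * (/ sin d ^ 2 + / d ^ 2)) / nu)
  with (2 * ((/ sin d + / d) / nu) + B / nu * 2) by (unfold B; field; repeat split; lra).
replace (Si (nu * (PI / 2)) - PI / 2) with (- (G (PI / 2) - G 0)).
- unfold Q in H2; apply Rabs_le_between in H1, H2, W1, W2; apply Rabs_le; lra.
- unfold G; rewrite dirichlet_primitive_PI2, dirichlet_primitive_0, Rmult_0_r, Si_0; ring.
Qed.

(** [Si_dirichlet] settles the odd multiples of [PI / 2]. Any large [x] lies less than [PI] above
    such a point [y], and [sinc] is at most [/ y] in absolute value in between. *)
Lemma Si_limit (eps : R) : 0 < eps ->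
  exists X, 0 < X /\ forall x, X <= x -> Rabs (Si x - PI / 2) < eps.
Proof.
intros He; pose proof PI2_1 as HPI.
set (d := Rmin 1 (eps / 4)).
assert (Hd : 0 < d <= 1) by (unfold d, Rmin; destruct Rle_dec; lra).
assert (Hde : d <= eps / 4) by apply Rmin_r.
set (K := 2 * (/ sin d + / d) + 2 * (/ (sin d) ^ 2 + / d ^ 2)).
(* The summand [4] leaves room for the passage from [y] to [x], which costs at most [2 / (2 N + 1)];
   [d <= eps / 4] covers the remaining term. *)
destruct (nfloor_ex (Rmax 0 ((Rabs K + 4) / (eps / 2))) (Rmax_l _ _)) as [N0 [_ HN0]].
assert (HN0' : (Rabs K + 4) / (eps / 2) < INR N0 + 1)
  by (apply Rle_lt_trans with (2 := HN0), Rmax_r).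
(* [S N0] instead of [N0] makes up for rounding [x] down to [y], a loss below [PI]. *)
exists ((2 * INR (S N0) + 1) * (PI / 2)); rewrite S_INR.
pose proof (pos_INR N0); split; [nra|].
intros x Hx.
destruct (nfloor_ex (x / PI - / 2)) as [N [HN1 HN2]].
{ assert (/ 2 <= x / PI) by (apply Rle_div_r; nra); lra. }
assert (HN3 : (2 * INR N + 1) * (PI / 2) <= x).
{ apply (Rmult_le_compat_r PI) in HN1; [|lra].
  replace ((x / PI - / 2) * PI) with (x - PI / 2) in HN1 by (field; lra); lra. }
assert (HN4 : x < (2 * INR N + 1) * (PI / 2) + PI).
{ apply (Rmult_lt_compat_r PI) in HN2; [|lra].
  replace ((x / PI - / 2) * PI) with (x - PI / 2) in HN2 by (field; lra); lra. }
set (y := (2 * INR N + 1) * (PI / 2)) in *.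
assert (HNN : INR N0 + 1 <= 2 * INR N + 1) by (unfold y in *; nra).
assert (Hpos : 0 < 2 * INR N + 1) by lra.
assert (Hlarge : (Rabs K + 4) / (2 * INR N + 1) < eps / 2).
{ apply Rlt_div_l; [lra|].
  apply Rlt_div_l in HN0'; [|lra]; nra. }
pose proof (Si_dirichlet N d Hd) as H1; fold K y in H1.
assert (Hy : 0 < y) by (unfold y; nra).
assert (H2 : Rabs (Si x - Si y) <= / y * (x - y)).
{ apply (increment_Lipschitz Si sinc); [lra| | |].
  - intros; apply is_derive_Si.
  - intros; eapply is_derive_continuity_pt, is_derive_Si.
  - intros u Hu; rewrite sinc_neq0 by lra.
    unfold Rdiv; rewrite Rabs_mult, <- (Rmult_1_l (/ y)).
    apply Rmult_le_compat; try apply Rabs_pos; [apply Rabs_le, SIN_bound|].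
    rewrite Rabs_pos_eq by (left; apply Rinv_0_lt_compat; lra).
    apply Rinv_le_contravar; lra. }
assert (H3 : / y * (x - y) <= 2 / (2 * INR N + 1)).
{ replace (2 / (2 * INR N + 1)) with (/ y * PI) by (unfold y; field; lra).
  apply Rmult_le_compat_l; [left; now apply Rinv_0_lt_compat | lra]. }
assert (H4 : K / (2 * INR N + 1) <= Rabs K / (2 * INR N + 1)).
{ apply Rmult_le_compat_r; [left; now apply Rinv_0_lt_compat | apply Rle_abs]. }
replace ((Rabs K + 4) / (2 * INR N + 1))
  with (Rabs K / (2 * INR N + 1) + 2 * (2 / (2 * INR N + 1))) in Hlarge by (field; lra).
assert (0 <= Rabs K / (2 * INR N + 1)).
{ apply Rle_div_r; [lra|]; rewrite Rmult_0_l; apply Rabs_pos. }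
apply Rabs_le_between in H1, H2; apply Rabs_lt_between; lra.
Qed.

Lemma Si_bounded : exists M, 0 < M /\ forall x, 0 <= x -> Rabs (Si x) <= M.
Proof.
destruct (Si_limit 1 Rlt_0_1) as [X [HX H]].
destruct (ex_RInt_bounded Si 0 X) as [M [HM HB]].
{ apply continuity_ex_RInt; intros x; eapply is_derive_continuity_pt, is_derive_Si. }
rewrite Rmin_left, Rmax_right in HB by lra.
exists (M + 3); split; [lra|]; intros x Hx.
destruct (Rle_dec x X) as [Hle|Hgt]; [specialize (HB x ltac:(lra)); lra|].
specialize (H x ltac:(lra)); pose proof PI_4; pose proof PI2_1.
apply Rabs_lt_between in H; apply Rabs_le; lra.
Qed.

(** * Oscillatory kernels on a half-line *)

(** Increments of [H] and [W] add up over the two halves of an interval, whereas the factor [y - x]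
    is halved; after [n] bisections the error term carries [2^(-n)]. *)
Lemma bisection_bound (H W : R -> R) (M K u v : R) : u <= v ->
  (forall x y, u <= x -> x <= y -> y <= v ->
     Rabs (H y - H x) <= (W y - W x) * (M + K * (y - x))) ->
  Rabs (H v - H u) <= (W v - W u) * M.
Proof.
intros Huv Hb.
assert (Hn : forall n x y, u <= x -> x <= y -> y <= v ->
   Rabs (H y - H x) <= (W y - W x) * (M + K * (y - x) * (/ 2) ^ n)).
{ induction n as [|n IH]; intros x y H1 H2 H3.
  - rewrite pow_O, Rmult_1_r; now apply Hb.
  - set (z := (x + y) / 2).
    pose proof (IH x z ltac:(lra) ltac:(unfold z; lra) ltac:(unfold z; lra)) as A1.
    pose proof (IH z y ltac:(unfold z; lra) ltac:(unfold z; lra) ltac:(lra)) as A2.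
    replace (K * (y - x) * (/ 2) ^ S n) with (K * (z - x) * (/ 2) ^ n)
      by (unfold z; simpl; field).
    replace (K * (y - z) * (/ 2) ^ n) with (K * (z - x) * (/ 2) ^ n) in A2
      by (unfold z; field).
    apply Rabs_le_between in A1, A2; apply Rabs_le; lra. }
apply le_epsilon; intros eps He.
set (C := Rabs ((W v - W u) * K * (v - u)) + 1).
assert (HC : 0 < C) by (unfold C; pose proof (Rabs_pos ((W v - W u) * K * (v - u))); lra).
destruct (pow_lt_1_zero (/ 2)) with (y := eps / C) as [N HN].
{ rewrite Rabs_pos_eq; lra. }
{ now apply Rdiv_lt_0_compat. }
specialize (HN N (le_n N)).
assert (Hp : 0 < (/ 2) ^ N) by (apply pow_lt; lra).
rewrite Rabs_pos_eq in HN by lra.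
apply Rlt_div_r in HN; [|assumption].
specialize (Hn N u v ltac:(lra) ltac:(lra) ltac:(lra)).
replace ((W v - W u) * (M + K * (v - u) * (/ 2) ^ N))
  with ((W v - W u) * M + (W v - W u) * K * (v - u) * (/ 2) ^ N) in Hn by ring.
assert (HCC : (W v - W u) * K * (v - u) <= C)
  by (unfold C; pose proof (Rle_abs ((W v - W u) * K * (v - u))); lra).
assert ((W v - W u) * K * (v - u) * (/ 2) ^ N <= C * (/ 2) ^ N)
  by (apply Rmult_le_compat_r; lra).
lra.
Qed.

(* Abel summation without Stieltjes integrals: the increments of
   [H x = RInt (g * D) u x - g x * RInt D u x] are controlled by those of [W] up to a
   factor [M + O(y - x)], and repeated bisection removes the error term. *)
Lemma RInt_BV_mult_le (D g W : R -> R) (M u v : R) : u <= v -> continuity D ->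
  (forall a b, ex_RInt g a b) ->
  (forall x y, u <= x -> x <= y -> y <= v -> Rabs (g y - g x) <= W y - W x) ->
  (forall w, u <= w <= v -> Rabs (RInt D u w) <= M) ->
  Rabs (RInt (fun t => g t * D t) u v) <= M * (Rabs (g v) + (W v - W u)).
Proof.
intros Huv HD Hg HW HM.
assert (HDex : forall a b, ex_RInt D a b) by (intros; now apply continuity_ex_RInt).
assert (Hex : forall a b, ex_RInt (fun t => g t * D t) a b)
  by (intros; apply ex_RInt_mult; auto).
destruct (ex_RInt_bounded D u v (HDex u v)) as [K [HK HDK]].
rewrite Rmin_left, Rmax_right in HDK by assumption.
set (H := fun x => RInt (fun t => g t * D t) u x - g x * RInt D u x).
assert (Hb : Rabs (H v - H u) <= (W v - W u) * M).
{ apply (bisection_bound H W M K); [assumption|]; intros x y Hx Hxy Hy.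
  (* The integral contains [g t - g y], so it is at most an increment of [W] times [K * (y - x)]:
     this is the error that bisection removes. The other term is already of the form wanted. *)
  assert (E : H y - H x = RInt (fun t => 1 * (g t * D t) + (- g y) * D t) x y
                           - (g y - g x) * RInt D u x).
  { rewrite RInt_comb by auto; unfold H.
    rewrite (RInt_split _ u y x Hex), (RInt_split D u y x HDex); ring. }
  rewrite E.
  assert (E1 : Rabs (RInt (fun t => 1 * (g t * D t) + (- g y) * D t) x y)
                 <= (y - x) * ((W y - W x) * K)).
  { apply abs_RInt_le_const; [assumption | apply ex_RInt_comb; auto |].
    intros t Ht.
    replace (1 * (g t * D t) + (- g y) * D t) with ((g t - g y) * D t) by ring.
    rewrite Rabs_mult; apply Rmult_le_compat; try apply Rabs_pos; [|apply HDK; lra].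
    rewrite Rabs_minus_sym.
    pose proof (HW t y ltac:(lra) ltac:(lra) ltac:(lra)).
    pose proof (HW x t ltac:(lra) ltac:(lra) ltac:(lra)).
    pose proof (Rabs_pos (g t - g x)); lra. }
  assert (E2 : Rabs ((g y - g x) * RInt D u x) <= (W y - W x) * M).
  { rewrite Rabs_mult; apply Rmult_le_compat; try apply Rabs_pos; [now apply HW | apply HM; lra]. }
  apply Rabs_le_between in E1, E2; apply Rabs_le; lra. }
unfold H in Hb.
rewrite (RInt_point (V := R_CompleteNormedModule) u (fun t => g t * D t)) in Hb.
rewrite (RInt_point (V := R_CompleteNormedModule) u D) in Hb.
change (@zero R_CompleteNormedModule) with 0 in Hb.
assert (E2 : Rabs (g v * RInt D u v) <= Rabs (g v) * M).
{ rewrite Rabs_mult; apply Rmult_le_compat_l; [apply Rabs_pos | apply HM; lra]. }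
apply Rabs_le_between in Hb, E2; apply Rabs_le; lra.
Qed.

(* Covers both halves of the kernel of [theorem2], the left one after [s |-> - s]; [mu] is the
   second derivative of the phase. *)
Record phase_kernel (D phi lam mu : R -> R) (T L m : R) : Prop := {
  pk_pos : 0 < m;
  pk_0 : phi 0 = 0;
  pk_phi : forall s, is_derive phi s (lam s);
  pk_lam : forall s, is_derive lam s (mu s);
  pk_mu : forall s, 0 <= s <= T -> Rabs (mu s) <= L * lam s;
  pk_m : forall s, 0 <= s <= T -> m <= lam s;
  pk_D : forall s, 0 < s -> D s = sin (phi s) / s;
  pk_cont : continuity D }.

Lemma phase_kernel_lower (D phi lam mu : R -> R) (T L m s : R) :
  phase_kernel D phi lam mu T L m -> 0 <= s <= T -> m * s <= phi s.
Proof.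
intros P Hs.
assert (H : m * s - m * 0 <= phi s - phi 0).
{ apply (increment_le (fun s => m * s) phi (fun _ => m) lam); try lra.
  - intros x _; auto_derive; [trivial | ring].
  - intros x _; apply (pk_phi _ _ _ _ _ _ _ P).
  - intros x _; apply (is_derive_continuity_pt _ _ m); auto_derive; [trivial | ring].
  - intros x _; eapply is_derive_continuity_pt, (pk_phi _ _ _ _ _ _ _ P).
  - intros x Hx; apply (pk_m _ _ _ _ _ _ _ P); lra. }
rewrite (pk_0 _ _ _ _ _ _ _ P) in H; lra.
Qed.

(** Both sides vanish at [0], and the derivatives compare: [s * mu s] is at most [L * s * lam s] in
    absolute value, while the right side has derivative [L * phi s + L * s * lam s] with
    [phi s >= 0]. *)
Lemma phase_kernel_linearity (D phi lam mu : R -> R) (T L m s : R) : 0 <= L ->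
  phase_kernel D phi lam mu T L m -> 0 <= s <= T ->
  Rabs (s * lam s - phi s) <= L * s * phi s.
Proof.
intros HL P Hs.
assert (H : Rabs ((s * lam s - phi s) - (0 * lam 0 - phi 0)) <= L * s * phi s - L * 0 * phi 0).
{ assert (D1 : forall x, is_derive (fun s => s * lam s - phi s) x (x * mu x)).
  { intros x; evar_last.
    - apply (is_derive_minus (V := R_NormedModule)); [|apply (pk_phi _ _ _ _ _ _ _ P)].
      apply (is_derive_mul (fun s => s) lam x 1 (mu x));
        [apply (is_derive_id (K := R_AbsRing)) | apply (pk_lam _ _ _ _ _ _ _ P)].
    - unfold minus, plus, opp; simpl; ring. }
  assert (D2 : forall x, is_derive (fun s => L * s * phi s) x (L * phi x + L * x * lam x)).
  { intros x; evar_last.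
    - apply (is_derive_mul (fun s => L * s) phi x L (lam x));
        [auto_derive; [trivial | ring] | apply (pk_phi _ _ _ _ _ _ _ P)].
    - ring. }
  apply (increment_Rabs_le _ (fun s => L * s * phi s) _ _ 0 s (proj1 Hs)
    (fun x _ => D1 x) (fun x _ => D2 x)).
  - intros x _; eapply is_derive_continuity_pt, D1.
  - intros x _; eapply is_derive_continuity_pt, D2.
  - intros x Hx; rewrite Rabs_mult, Rabs_pos_eq by lra.
    pose proof (pk_mu _ _ _ _ _ _ _ P x ltac:(lra)) as H1.
    pose proof (phase_kernel_lower _ _ _ _ _ _ _ x P ltac:(lra)) as H2.
    pose proof (pk_pos _ _ _ _ _ _ _ P).
    assert (0 <= L * phi x) by (apply Rmult_le_pos; nra).
    apply (Rmult_le_compat_l x) in H1; lra. }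
rewrite (pk_0 _ _ _ _ _ _ _ P) in H.
replace (s * lam s - phi s - (0 * lam 0 - 0)) with (s * lam s - phi s) in H by ring; lra.
Qed.

(** The difference has derivative [sin (phi s) * (1 / s - lam s / phi s)], and
    [phase_kernel_linearity] bounds the bracket by [L]. The slope bound [m] does not appear, so the
    estimate is uniform along a family of kernels. *)
Lemma RInt_phase_kernel_near (D phi lam mu : R -> R) (T L m s : R) : 0 <= L ->
  phase_kernel D phi lam mu T L m -> 0 <= s <= T ->
  Rabs (RInt D 0 s - Si (phi s)) <= L * s.
Proof.
intros HL P Hs.
set (G := fun s => RInt D 0 s - Si (phi s)).
assert (HG : forall x, is_derive G x (D x - lam x * sinc (phi x))).
{ intros x; apply (is_derive_minus (V := R_NormedModule)).
  - apply is_derive_primitive, (pk_cont _ _ _ _ _ _ _ P).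
  - apply (is_derive_comp (V := R_NormedModule) Si phi);
      [apply is_derive_Si | apply (pk_phi _ _ _ _ _ _ _ P)]. }
assert (H : Rabs (G s - G 0) <= L * (s - 0)).
{ apply (increment_Lipschitz G _ L 0 s (proj1 Hs) (fun x _ => HG x)).
  - intros x _; eapply is_derive_continuity_pt, HG.
  - intros x Hx.
    pose proof (phase_kernel_lower _ _ _ _ _ _ _ x P ltac:(lra)) as H2.
    pose proof (pk_pos _ _ _ _ _ _ _ P).
    assert (Hphi : 0 < phi x) by nra.
    pose proof (phase_kernel_linearity _ _ _ _ _ _ _ x HL P ltac:(lra)) as H3.
    rewrite (pk_D _ _ _ _ _ _ _ P x), sinc_neq0 by lra.
    replace (sin (phi x) / x - lam x * (sin (phi x) / phi x))
      with (sin (phi x) * (- (x * lam x - phi x) / (x * phi x))) by (field; lra).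
    rewrite Rabs_mult, <- (Rmult_1_l L).
    apply Rmult_le_compat; try apply Rabs_pos; [apply Rabs_le, SIN_bound|].
    assert (0 < x * phi x) by (apply Rmult_lt_0_compat; lra).
    rewrite Rabs_div, Rabs_Ropp, (Rabs_pos_eq (x * phi x)) by lra.
    apply Rle_div_l; lra. }
unfold G at 2 in H.
rewrite (pk_0 _ _ _ _ _ _ _ P), Si_0, (RInt_point (V := R_CompleteNormedModule)) in H.
change (@zero R_CompleteNormedModule) with 0 in H; unfold G in H.
replace (RInt D 0 s - Si (phi s) - (0 - 0)) with (RInt D 0 s - Si (phi s)) in H by ring.
lra.
Qed.

(** Integration by parts for [D = (lam * sin phi) * w] with [w = 1 / (s * lam)]: each boundary term
    is at most [1 / (d * m)], and [w'] is at most [(L / d + 1 / d^2) / m] because [mu] is bounded by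
    [L * lam]. *)
Lemma RInt_phase_kernel_far (D phi lam mu : R -> R) (T L m d y : R) : 0 <= L ->
  phase_kernel D phi lam mu T L m -> 0 < d -> d <= y -> y <= T ->
  Rabs (RInt D d y) <= (2 / d + T * (L / d + / d ^ 2)) / m.
Proof.
intros HL P Hd Hdy Hy.
pose proof (pk_pos _ _ _ _ _ _ _ P) as Hm.
assert (Hlam : forall x, d <= x <= y -> m <= lam x)
  by (intros; apply (pk_m _ _ _ _ _ _ _ P); lra).
set (w := fun x => / (x * lam x)).
set (G := fun x => RInt D d x + cos (phi x) * w x).
set (B := (L / d + / d ^ 2) / m).
assert (HG : forall x, d <= x <= y ->
   is_derive G x (cos (phi x) * (- (lam x + x * mu x) / (x * lam x) ^ 2))).
{ intros x Hx; pose proof (Hlam x Hx).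
  evar_last.
  - apply (is_derive_plus (V := R_NormedModule));
      [apply is_derive_primitive, (pk_cont _ _ _ _ _ _ _ P)|].
    apply (is_derive_mul (fun x => cos (phi x)) w).
    + apply (is_derive_comp (V := R_NormedModule) cos phi);
        [apply is_derive_cos | apply (pk_phi _ _ _ _ _ _ _ P)].
    + apply (is_derive_inv (fun x => x * lam x)); [|nra].
      apply (is_derive_mul (fun x => x) lam x 1 (mu x));
        [apply (is_derive_id (K := R_AbsRing)) | apply (pk_lam _ _ _ _ _ _ _ P)].
  - rewrite (pk_D _ _ _ _ _ _ _ P x) by lra.
    unfold w, plus, mult, scal, one; simpl; unfold mult; simpl; field; lra. }
assert (H : Rabs (G y - G d) <= B * (y - d)).
{ apply (increment_Lipschitz G
    (fun x => cos (phi x) * (- (lam x + x * mu x) / (x * lam x) ^ 2))); [assumption| | |].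
  - intros x Hx; apply HG; lra.
  - intros x Hx; eapply is_derive_continuity_pt, HG; lra.
  - intros x Hx; pose proof (Hlam x ltac:(lra)) as Hl.
    pose proof (pk_mu _ _ _ _ _ _ _ P x ltac:(lra)) as Hmu.
    rewrite Rabs_mult, <- (Rmult_1_l B).
    apply Rmult_le_compat; try apply Rabs_pos; [apply Rabs_le, COS_bound|].
    assert (Hsq : 0 < (x * lam x) ^ 2) by (apply pow_lt; nra).
    rewrite Rabs_div, Rabs_Ropp, (Rabs_pos_eq ((x * lam x) ^ 2)) by lra.
    apply Rle_trans with ((lam x + x * (L * lam x)) / (x * lam x) ^ 2).
    + apply Rmult_le_compat_r; [left; now apply Rinv_0_lt_compat|].
      apply Rle_trans with (1 := Rabs_triang _ _).
      rewrite Rabs_mult, !(Rabs_pos_eq (lam x)), (Rabs_pos_eq x) by lra.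
      apply Rplus_le_compat_l, Rmult_le_compat_l; lra.
    + replace ((lam x + x * (L * lam x)) / (x * lam x) ^ 2)
        with ((L * / x + / x ^ 2) * / lam x) by (field; lra).
      assert (0 < / lam x <= / m)
        by (split; [apply Rinv_0_lt_compat | apply Rinv_le_contravar]; lra).
      assert (0 < / x <= / d)
        by (split; [apply Rinv_0_lt_compat | apply Rinv_le_contravar]; lra).
      assert (0 < / x ^ 2 <= / d ^ 2).
      { split; [apply Rinv_0_lt_compat, pow_lt; lra | apply Rinv_le_contravar].
        - apply pow_lt; lra.
        - apply pow_incr; lra. }
      assert (0 <= L * / x <= L * / d) by (split; [apply Rmult_le_pos | apply Rmult_le_compat_l]; lra).
      unfold B, Rdiv; apply Rmult_le_compat; lra. }
assert (Hw : forall x, d <= x <= y -> Rabs (cos (phi x) * w x) <= / (d * m)).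
{ intros x Hx; pose proof (Hlam x Hx).
  rewrite Rabs_mult, <- (Rmult_1_l (/ (d * m))).
  apply Rmult_le_compat; try apply Rabs_pos; [apply Rabs_le, COS_bound|].
  unfold w; rewrite Rabs_pos_eq by (left; apply Rinv_0_lt_compat; nra).
  apply Rinv_le_contravar; nra. }
pose proof (Hw d ltac:(lra)) as W1; pose proof (Hw y ltac:(lra)) as W2.
assert (HB : 0 <= B).
{ unfold B, Rdiv; apply Rmult_le_pos; [apply Rplus_le_le_0_compat|left; now apply Rinv_0_lt_compat].
  - apply Rmult_le_pos; [assumption | left; now apply Rinv_0_lt_compat].
  - left; apply Rinv_0_lt_compat, pow_lt; lra. }
assert (HBT : B * (y - d) <= B * T) by (apply Rmult_le_compat_l; lra).
replace ((2 / d + T * (L / d + / d ^ 2)) / m) with (2 * / (d * m) + B * T)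
  by (unfold B; field; lra).
unfold G in H.
rewrite (RInt_point (V := R_CompleteNormedModule)) in H.
change (@zero R_CompleteNormedModule) with 0 in H.
apply Rabs_le_between in H, W1, W2; apply Rabs_le; lra.
Qed.

(** The integral splits into [g - g 0] on [[0, d]], the constant [g 0] on [[0, d]], and [g] on
    [[d, T]]. The first is small by right continuity of [W] at [0], the second is close to
    [PI / 2 * g 0], the third is [O(1 / m n)] with [d] fixed. *)
Lemma RInt_phase_kernels_limit (D phi lam mu : nat -> R -> R) (m : nat -> R)
    (T L : R) (g W : R -> R) :
  0 < T -> 0 <= L ->
  (forall n, (1 <= n)%nat -> phase_kernel (D n) (phi n) (lam n) (mu n) T L (m n)) ->
  cv_infty m -> (forall a b, ex_RInt g a b) ->
  (forall x y, 0 <= x -> x <= y -> Rabs (g y - g x) <= W y - W x) ->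
  (forall eps, 0 < eps -> exists d, 0 < d /\ forall s, 0 < s < d -> W s - W 0 < eps) ->
  forall eps, 0 < eps -> exists N, forall n, (N <= n)%nat ->
    Rabs (RInt (fun s => g s * D n s) 0 T - PI / 2 * g 0) < eps.
Proof.
intros HT HL HP Hm Hg HW Hr eps He.
destruct Si_bounded as [MS [HMS HSi]].
(* [M] bounds the primitive from [0] of every kernel at once on [[0, T]]. *)
set (M := MS + L * T).
assert (HLT : 0 <= L * T) by (apply Rmult_le_pos; lra).
assert (HM : 0 < M) by (unfold M; lra).
destruct (Hr (eps / (8 * M))) as [d0 [Hd0 Hr0]]; [apply Rdiv_lt_0_compat; lra|].
set (G0 := Rabs (g 0)).
assert (HG0 : 0 <= G0) by apply Rabs_pos.
assert (HGL : 0 <= G0 * L) by now apply Rmult_le_pos.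
(* The added [1], here and in [G0 + 1] below, keeps the denominator positive when [g 0] or [L] is
   zero. *)
set (e1 := eps / (4 * (G0 * L + 1))).
assert (He1 : 0 < e1) by (apply Rdiv_lt_0_compat; lra).
set (d := Rmin T (Rmin (d0 / 2) e1)).
assert (Hd : 0 < d) by (unfold d, Rmin; repeat destruct Rle_dec; lra).
assert (HdT : d <= T) by apply Rmin_l.
assert (Hdd : d <= d0 / 2) by (eapply Rle_trans; [apply Rmin_r | apply Rmin_l]).
assert (Hde : d <= e1) by (eapply Rle_trans; [apply Rmin_r | apply Rmin_r]).
assert (HLd : G0 * (L * d) < eps / 4).
{ apply Rle_lt_trans with (G0 * L * e1).
  - rewrite <- Rmult_assoc; apply Rmult_le_compat_l; lra.
  - replace (eps / 4) with ((G0 * L + 1) * e1) by (unfold e1; field; lra); lra. }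
specialize (Hr0 d ltac:(lra)).
assert (H1' : M * (2 * (W d - W 0)) < eps / 4).
{ apply (Rmult_lt_compat_l (2 * M)) in Hr0; [|lra].
  replace (2 * M * (eps / (8 * M))) with (eps / 4) in Hr0 by (field; lra); lra. }
destruct (Si_limit (eps / (4 * (G0 + 1)))) as [X [HX HSX]]; [apply Rdiv_lt_0_compat; lra|].
set (C := 2 / d + T * (L / d + / d ^ 2)).
set (Q := Rabs (g T) + (W T - W 0)).
(* [X / d < m n] pushes [phi n d] beyond [X], where [Si] is close to [PI / 2]; the second bound
   makes the part on [[d, T]] smaller than [eps / 4]. *)
destruct (Hm (Rmax (X / d) (4 * Rabs (C * Q) / eps))) as [N HN].
(* The successor guarantees [1 <= n], as the kernel hypotheses start at index [1]. *)
exists (S N); intros n Hn.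
specialize (HN n ltac:(lia)); specialize (HP n ltac:(lia)).
assert (HN1 : X / d < m n) by (apply Rle_lt_trans with (2 := HN), Rmax_l).
assert (HN2 : 4 * Rabs (C * Q) / eps < m n) by (apply Rle_lt_trans with (2 := HN), Rmax_r).
pose proof (pk_pos _ _ _ _ _ _ _ HP) as Hmn.
pose proof (pk_cont _ _ _ _ _ _ _ HP) as HDc.
assert (HDex : forall a b, ex_RInt (D n) a b) by (intros; now apply continuity_ex_RInt).
assert (Hex : forall a b, ex_RInt (fun t => g t * D n t) a b)
  by (intros; apply ex_RInt_mult; auto).
assert (Hcex : forall a b, ex_RInt (fun t => g t - g 0) a b).
{ intros; apply (ex_RInt_minus (V := R_NormedModule)); [auto|].
  apply (ex_RInt_const (V := R_NormedModule)). }
assert (Hphi : forall w, 0 <= w <= T -> 0 <= phi n w).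
{ intros w Hw; pose proof (phase_kernel_lower _ _ _ _ _ _ _ w HP Hw); nra. }
assert (B1 : Rabs (RInt (fun t => (g t - g 0) * D n t) 0 d) <= M * (2 * (W d - W 0))).
{ apply Rle_trans with (M * (Rabs (g d - g 0) + (W d - W 0))).
  - apply (RInt_BV_mult_le (D n) (fun t => g t - g 0) W); try lra; auto.
    + intros x y Hx Hxy _; replace (g y - g 0 - (g x - g 0)) with (g y - g x) by ring; auto.
    + intros w Hw.
      pose proof (RInt_phase_kernel_near _ _ _ _ _ _ _ w HL HP ltac:(lra)) as E1.
      pose proof (HSi (phi n w) (Hphi w ltac:(lra))) as E2.
      assert (L * w <= L * T) by (apply Rmult_le_compat_l; lra).
      apply Rabs_le_between in E1, E2; apply Rabs_le; unfold M; lra.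
  - apply Rmult_le_compat_l; [lra|].
    pose proof (HW 0 d ltac:(lra) ltac:(lra)); lra. }
assert (B2 : Rabs (g 0 * (RInt (D n) 0 d - PI / 2)) < eps / 2).
{ rewrite Rabs_mult; fold G0.
  pose proof (RInt_phase_kernel_near _ _ _ _ _ _ _ d HL HP ltac:(lra)) as E1.
  assert (E2 : Rabs (Si (phi n d) - PI / 2) < eps / (4 * (G0 + 1))).
  { apply HSX; pose proof (phase_kernel_lower _ _ _ _ _ _ _ d HP ltac:(lra)).
    apply Rlt_div_l in HN1; lra. }
  assert (E3 : Rabs (RInt (D n) 0 d - PI / 2) <= L * d + eps / (4 * (G0 + 1))).
  { apply Rabs_le_between in E1; apply Rabs_lt_between in E2; apply Rabs_le; lra. }
  apply (Rmult_le_compat_l G0) in E3; [|assumption].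
  assert (E4 : G0 * (eps / (4 * (G0 + 1))) <= eps / 4).
  { replace (eps / 4) with ((G0 + 1) * (eps / (4 * (G0 + 1)))) by (field; lra).
    apply Rmult_le_compat_r; [left; apply Rdiv_lt_0_compat; lra | lra]. }
  lra. }
assert (HC : 0 <= C).
{ assert (0 < / d ^ 2) by (apply Rinv_0_lt_compat, pow_lt; lra).
  assert (0 <= L / d) by (apply Rmult_le_pos; [assumption | left; now apply Rinv_0_lt_compat]).
  assert (0 < 2 / d) by (apply Rdiv_lt_0_compat; lra).
  unfold C; apply Rplus_le_le_0_compat; [lra | apply Rmult_le_pos; lra]. }
assert (B3 : Rabs (RInt (fun t => g t * D n t) d T) < eps / 4).
{ apply Rle_lt_trans with (C / m n * (Rabs (g T) + (W T - W d))).
  - apply (RInt_BV_mult_le (D n) g W); try lra; auto.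
    + intros x y Hx Hxy _; apply HW; lra.
    + intros w Hw; apply (RInt_phase_kernel_far _ _ _ _ _ _ _ d w HL HP); lra.
  - apply Rle_lt_trans with (C / m n * Q).
    + apply Rmult_le_compat_l; [apply Rmult_le_pos; [assumption | left; now apply Rinv_0_lt_compat]|].
      unfold Q; pose proof (HW 0 d ltac:(lra) ltac:(lra)).
      pose proof (Rabs_pos (g d - g 0)); lra.
    + replace (C / m n * Q) with (C * Q / m n) by (field; lra).
      apply Rlt_div_l; [assumption|]; apply Rlt_div_l in HN2; [|assumption].
      pose proof (Rle_abs (C * Q)); lra. }
rewrite (RInt_split _ 0 T d Hex).
assert (E : RInt (fun t => (g t - g 0) * D n t) 0 d
             = RInt (fun t => g t * D n t) 0 d - g 0 * RInt (D n) 0 d :> R).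
{ transitivity (RInt (fun t => 1 * (g t * D n t) + (- g 0) * D n t) 0 d).
  - apply RInt_ext; intros t _; simpl; ring.
  - rewrite RInt_comb by auto; ring. }
rewrite E in B1.
apply Rabs_le_between in B1; apply Rabs_lt_between in B2, B3; apply Rabs_lt_between; lra.
Qed.

(** * The kernel of the partial sums *)

Ltac Cx_ring := unfold Cadd, Csub, Copp, Cmul, Cscale, Cconj, RtoC, C0, C1 in *;
  apply injective_projections; simpl; ring.

Lemma Csum_ext (n : nat) (u v : nat -> Cx) :
  (forall k, (k < n)%nat -> u k = v k) -> Csum n u = Csum n v.
Proof.
induction n as [|n IH]; intros H; [reflexivity|]; cbn [Csum].
rewrite IH, H; auto with arith.
Qed.

Lemma Csum_front (n : nat) (u : nat -> Cx) :
  Csum (S n) u = Cadd (u 0%nat) (Csum n (fun k => u (S k))).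
Proof.
induction n as [|n IH]; [cbn [Csum]; Cx_ring|].
change (Csum (S (S n)) u) with (Cadd (Csum (S n) u) (u (S n))); rewrite IH.
cbn [Csum]; Cx_ring.
Qed.

(** The range from [-n] to [n - 1] is symmetric about [-1/2], so [j] is paired with [-(j + 1)]; on
    the real axis the functions with these two indices are conjugate. *)
Lemma Csum_symmetric (F : Z -> Cx) (n : nat) :
  Csum (2 * n) (fun j => F (Z.of_nat j - Z.of_nat n)%Z)
    = Csum n (fun j => Cadd (F (Z.of_nat j)) (F (- Z.of_nat (S j))%Z)).
Proof.
induction n as [|n IH]; [reflexivity|].
replace (2 * S n)%nat with (S (S (2 * n))) by lia.
rewrite Csum_front; cbn [Csum]; rewrite <- IH.
rewrite (Csum_ext _ (fun k => F (Z.of_nat (S k) - Z.of_nat (S n))%Z)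
  (fun j => F (Z.of_nat j - Z.of_nat n)%Z)) by (intros; f_equal; lia).
replace (Z.of_nat (S (2 * n)) - Z.of_nat (S n))%Z with (Z.of_nat n) by lia.
replace (Z.of_nat 0 - Z.of_nat (S n))%Z with (- Z.of_nat (S n))%Z by lia.
Cx_ring.
Qed.

Lemma Cnorm2_mul (z w : Cx) : Cnorm2 (Cmul z w) = Cnorm2 z * Cnorm2 w.
Proof. unfold Cnorm2, Cmul; simpl; ring. Qed.

Lemma Cnorm2_conj (z : Cx) : Cnorm2 (Cconj z) = Cnorm2 z.
Proof. unfold Cnorm2, Cconj; simpl; ring. Qed.

Lemma Cnorm2_ge0 (z : Cx) : 0 <= Cnorm2 z.
Proof. unfold Cnorm2; nra. Qed.

Lemma Cconj_mul (z w : Cx) : Cconj (Cmul z w) = Cmul (Cconj z) (Cconj w).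
Proof. Cx_ring. Qed.

Lemma Cconj_inv (z : Cx) : Cconj (Cinv z) = Cinv (Cconj z).
Proof.
unfold Cinv; rewrite Cnorm2_conj; unfold Cconj; apply injective_projections; simpl;
  unfold Rdiv; ring.
Qed.

Lemma Cconj_prod (n : nat) (u v : nat -> Cx) : (forall k, Cconj (u k) = v k) ->
  Cconj (Cprod n u) = Cprod n v.
Proof.
intros H; induction n as [|n IH]; cbn [Cprod]; [Cx_ring|].
now rewrite Cconj_mul, IH, H.
Qed.

Lemma Cnorm2_chi (w : Cx) : Cnorm2 (chi w) = 1.
Proof.
unfold chi; destruct Req_EM_T as [_|H]; [unfold Cnorm2, C1; simpl; ring|].
set (d := Cadd C1 (Cmul w w)) in *; clearbody d.
assert (Hs : Cmod d * Cmod d = Cnorm2 d) by (apply sqrt_sqrt, Cnorm2_ge0).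
unfold Cnorm2 at 1, Cscale, Cinv; simpl.
replace (Cmod d * (fst d / Cnorm2 d) * (Cmod d * (fst d / Cnorm2 d)) +
  Cmod d * (- snd d / Cnorm2 d) * (Cmod d * (- snd d / Cnorm2 d)))
  with ((Cmod d * Cmod d) * Cnorm2 d / (Cnorm2 d * Cnorm2 d))
  by (unfold Cnorm2 at 1; field; assumption).
rewrite Hs; field; assumption.
Qed.

Lemma chi_conj (w : Cx) : chi (Cconj w) = Cconj (chi w).
Proof.
unfold chi.
assert (E : Cadd C1 (Cmul (Cconj w) (Cconj w)) = Cconj (Cadd C1 (Cmul w w))) by Cx_ring.
rewrite E, Cnorm2_conj; unfold Cmod; rewrite Cnorm2_conj, <- Cconj_inv.
destruct Req_EM_T; Cx_ring.
Qed.

Lemma Bfac_conj (w : Cx) (t : R) : Bfac (Cconj w) (RtoC t) = Cconj (Bfac w (RtoC t)).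
Proof.
unfold Bfac, Cdiv; rewrite !Cconj_mul, chi_conj, Cconj_inv.
replace (Cconj (Csub (RtoC t) w)) with (Csub (RtoC t) (Cconj w)) by Cx_ring.
now replace (Cconj (Csub (RtoC t) (Cconj w))) with (Csub (RtoC t) (Cconj (Cconj w))) by Cx_ring.
Qed.

(** At a real argument conjugation commutes with every factor, and the index shift in [bseq] turns
    [b_(j+1)] into the conjugate of [a_j]. This is why the kernel of the partial sums is real. *)
Lemma Phiminus_conj (a : nat -> Cx) (j : nat) (t : R) :
  Phiminus a (S j) (RtoC t) = Cconj (Phiplus a j (RtoC t)).
Proof.
unfold Phiminus, Phiplus, Bminus, Bplus, Cdiv; rewrite !Cconj_mul, Cconj_inv.
change (bseq a (S j)) with (Cconj (a j)); change (Nat.pred (S j)) with j.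
rewrite (Cconj_prod j _ (fun i => Bfac (bseq a (S i)) (RtoC t)))
  by (intros k; symmetry; apply Bfac_conj).
replace (- CIm (Cconj (a j))) with (CIm (a j)) by (unfold CIm, Cconj; simpl; ring).
replace (Cconj (RtoC (sqrt (CIm (a j))))) with (RtoC (sqrt (CIm (a j)))) by Cx_ring.
now replace (Cconj (Csub (RtoC t) (Cconj (a j)))) with (Csub (RtoC t) (Cconj (Cconj (a j))))
  by Cx_ring.
Qed.

Lemma Phi_nonneg (a : nat -> Cx) (j : nat) (z : Cx) : Phi a (Z.of_nat j) z = Phiplus a j z.
Proof.
unfold Phi; replace (0 <=? Z.of_nat j)%Z with true by (symmetry; apply Z.leb_le; lia).
now rewrite Nat2Z.id.
Qed.

Lemma Phi_neg (a : nat -> Cx) (j : nat) (t : R) :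
  Phi a (- Z.of_nat (S j)) (RtoC t) = Cconj (Phiplus a j (RtoC t)).
Proof.
unfold Phi; replace (0 <=? - Z.of_nat (S j))%Z with false by (symmetry; apply Z.leb_gt; lia).
replace (Z.to_nat (- - Z.of_nat (S j))) with (S j) by lia; apply Phiminus_conj.
Qed.

Lemma Z_nonneg_or_neg (P : Z -> Prop) :
  (forall j, P (Z.of_nat j)) -> (forall j, P (- Z.of_nat (S j))%Z) -> forall k, P k.
Proof.
intros H1 H2 k; destruct (Z_le_gt_dec 0 k).
- replace k with (Z.of_nat (Z.to_nat k)) by lia; apply H1.
- replace k with (- Z.of_nat (S (Z.to_nat (- k - 1))))%Z by lia; apply H2.
Qed.

(** * Blaschke products and the phase on the real axis *)

Lemma Cauchy_factor (w : Cx) (s t : R) :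
  Cdiv (RtoC s) (Csub (RtoC t) (Cconj w))
    = (s * (t - fst w) / ((t - fst w) ^ 2 + snd w ^ 2),
       - (s * snd w) / ((t - fst w) ^ 2 + snd w ^ 2)).
Proof.
unfold Cdiv, Cinv, Cnorm2, Cmul, RtoC, Csub, Cadd, Copp, Cconj; simpl.
replace ((t + - fst w) * (t + - fst w) + (0 + - - snd w) * (0 + - - snd w))
  with ((t - fst w) ^ 2 + snd w ^ 2) by ring.
apply injective_projections; simpl; unfold Rdiv; ring.
Qed.

Lemma Blaschke_factor (w : Cx) (t : R) :
  Cdiv (Csub (RtoC t) w) (Csub (RtoC t) (Cconj w))
    = (((t - fst w) ^ 2 - snd w ^ 2) / ((t - fst w) ^ 2 + snd w ^ 2),
       - (2 * (t - fst w) * snd w) / ((t - fst w) ^ 2 + snd w ^ 2)).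
Proof.
unfold Cdiv, Cinv, Cnorm2, Cmul, RtoC, Csub, Cadd, Copp, Cconj; simpl.
replace ((t + - fst w) * (t + - fst w) + (0 + - - snd w) * (0 + - - snd w))
  with ((t - fst w) ^ 2 + snd w ^ 2) by ring.
apply injective_projections; simpl; unfold Rdiv; ring.
Qed.

Lemma dist2_pos (w : Cx) (t : R) : 0 < snd w -> 0 < (t - fst w) ^ 2 + snd w ^ 2.
Proof. intros H; pose proof (pow2_ge_0 (t - fst w)); pose proof (pow_lt _ 2 H); lra. Qed.

Lemma Cnorm2_Bfac (w : Cx) (t : R) : 0 < snd w -> Cnorm2 (Bfac w (RtoC t)) = 1.
Proof.
intros Hw; pose proof (dist2_pos w t Hw).
unfold Bfac; rewrite Cnorm2_mul, Cnorm2_chi, Blaschke_factor.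
unfold Cnorm2; simpl fst; simpl snd; field; lra.
Qed.

Lemma Cnorm2_Bplus (a : nat -> Cx) (n : nat) (t : R) : (forall k, 0 < CIm (a k)) ->
  Cnorm2 (Bplus a n (RtoC t)) = 1.
Proof.
intros Ha; unfold Bplus; induction n as [|n IH]; cbn [Cprod].
- unfold Cnorm2, C1; simpl; ring.
- rewrite Cnorm2_mul, IH, Cnorm2_Bfac by apply Ha; ring.
Qed.

(** Since the Blaschke product is unimodular, the squared modulus is [Im a_j / |t - a_j|^2], at most
    [1 / Im a_j]. *)
Lemma Phi_bounded (a : nat -> Cx) (k : Z) : (forall k, 0 < CIm (a k)) ->
  exists M, 0 < M /\ forall t, Rabs (fst (Phi a k (RtoC t))) <= M /\
                               Rabs (snd (Phi a k (RtoC t))) <= M.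
Proof.
intros Ha.
assert (H : forall j, exists M, 0 < M /\ forall t, Cnorm2 (Phiplus a j (RtoC t)) <= M).
{ intros j; exists (/ snd (a j)); pose proof (Ha j) as Hj; unfold CIm in Hj.
  split; [now apply Rinv_0_lt_compat|]; intros t; pose proof (dist2_pos (a j) t Hj).
  unfold Phiplus; rewrite Cnorm2_mul, Cnorm2_Bplus, Rmult_1_r, Cauchy_factor by assumption.
  unfold Cnorm2, CIm; cbn [fst snd].
  replace (sqrt (snd (a j)) * (t - fst (a j)) / ((t - fst (a j)) ^ 2 + snd (a j) ^ 2) *
   (sqrt (snd (a j)) * (t - fst (a j)) / ((t - fst (a j)) ^ 2 + snd (a j) ^ 2)) +
   - (sqrt (snd (a j)) * snd (a j)) / ((t - fst (a j)) ^ 2 + snd (a j) ^ 2) *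
   (- (sqrt (snd (a j)) * snd (a j)) / ((t - fst (a j)) ^ 2 + snd (a j) ^ 2)))
   with ((sqrt (snd (a j)) * sqrt (snd (a j))) / ((t - fst (a j)) ^ 2 + snd (a j) ^ 2))
   by (field; lra).
  rewrite sqrt_sqrt by lra.
  apply Rle_div_l; [assumption|].
  apply Rmult_le_reg_l with (snd (a j)); [assumption|].
  rewrite <- Rmult_assoc, Rinv_r, Rmult_1_l by lra; pose proof (pow2_ge_0 (t - fst (a j))); lra. }
(* [M + 1] avoids a square root: [x^2 <= M] implies [|x| <= M + 1]. *)
assert (H2 : forall z M, 0 < M -> Cnorm2 z <= M -> Rabs (fst z) <= M + 1 /\ Rabs (snd z) <= M + 1).
{ intros z M HM Hz; unfold Cnorm2 in Hz; split; apply Rabs_le; split; nra. }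
pattern k; apply Z_nonneg_or_neg; intros j; destruct (H j) as [M [HM HB]];
  exists (M + 1); (split; [lra|]); intros t.
- rewrite Phi_nonneg; now apply H2.
- rewrite Phi_neg; apply H2; [assumption|]; rewrite Cnorm2_conj; apply HB.
Qed.

Definition Ccontinuous (F : R -> Cx) : Prop :=
  continuity (fun t => fst (F t)) /\ continuity (fun t => snd (F t)).

Lemma Ccontinuous_mul (F G : R -> Cx) : Ccontinuous F -> Ccontinuous G ->
  Ccontinuous (fun t => Cmul (F t) (G t)).
Proof.
intros [F1 F2] [G1 G2]; split; intros t; simpl.
- apply continuity_pt_minus;
    [apply (continuity_pt_mult (fun t => fst (F t)) (fun t => fst (G t)))
    |apply (continuity_pt_mult (fun t => snd (F t)) (fun t => snd (G t)))]; auto.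
- apply continuity_pt_plus;
    [apply (continuity_pt_mult (fun t => fst (F t)) (fun t => snd (G t)))
    |apply (continuity_pt_mult (fun t => snd (F t)) (fun t => fst (G t)))]; auto.
Qed.

Lemma Ccontinuous_conj (F : R -> Cx) : Ccontinuous F -> Ccontinuous (fun t => Cconj (F t)).
Proof. intros [F1 F2]; split; intros t; simpl; [apply F1 | apply continuity_pt_opp, F2]. Qed.

Lemma Ccontinuous_const (z : Cx) : Ccontinuous (fun _ => z).
Proof. split; intros t; apply continuity_pt_const; now intros ? ?. Qed.

Lemma Ccontinuous_ext (F G : R -> Cx) : (forall t, F t = G t) -> Ccontinuous F -> Ccontinuous G.
Proof.
intros E [F1 F2]; split; intros t.
- apply (continuity_pt_ext (fun t => fst (F t))); [intros; now rewrite E | apply F1].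
- apply (continuity_pt_ext (fun t => snd (F t))); [intros; now rewrite E | apply F2].
Qed.

Lemma ex_derive_continuity (f : R -> R) : (forall t, ex_derive f t) -> continuity f.
Proof. intros H t; destruct (H t) as [l Hl]; now apply (is_derive_continuity_pt f t l). Qed.

Lemma Ccontinuous_Phi (a : nat -> Cx) (k : Z) : (forall k, 0 < CIm (a k)) ->
  Ccontinuous (fun t => Phi a k (RtoC t)).
Proof.
intros Ha.
assert (HB : forall n, Ccontinuous (fun t => Bplus a n (RtoC t))).
{ unfold Bplus; induction n as [|n IH]; cbn [Cprod]; [apply Ccontinuous_const|].
  apply (Ccontinuous_mul _ (fun t => Bfac (a n) (RtoC t)) IH); unfold Bfac.
  apply (Ccontinuous_mul (fun _ => chi (a n))); [apply Ccontinuous_const|].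
  apply (Ccontinuous_ext _ _ (fun t => eq_sym (Blaschke_factor (a n) t))).
  split; apply ex_derive_continuity; intros t; cbn [fst snd];
    pose proof (dist2_pos (a n) t (Ha n)); auto_derive; simpl in *; lra. }
assert (HP : forall j, Ccontinuous (fun t => Phiplus a j (RtoC t))).
{ intros j; unfold Phiplus.
  apply (Ccontinuous_mul _ (fun t => Bplus a j (RtoC t))); [|apply HB].
  apply (Ccontinuous_ext _ _ (fun t => eq_sym (Cauchy_factor (a j) _ t))).
  split; apply ex_derive_continuity; intros t; cbn [fst snd];
    pose proof (dist2_pos (a j) t (Ha j)); auto_derive; simpl in *; lra. }
pattern k; apply Z_nonneg_or_neg; intros j.
- apply (Ccontinuous_ext (fun t => Phiplus a j (RtoC t))); [intros; now rewrite Phi_nonneg | apply HP].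
- apply (Ccontinuous_ext (fun t => Cconj (Phiplus a j (RtoC t)))); [intros; now rewrite Phi_neg |].
  apply Ccontinuous_conj, HP.
Qed.

(** A branch, smooth on the whole line, of the argument of minus the Blaschke factor
    [(t - w) / (t - conj w)]. The signs cancel in [B(x) * conj B(x + s)]. *)
Definition phase_term (w : Cx) (t : R) : R := 2 * atan ((t - fst w) / snd w).
Definition phase (a : nat -> Cx) (n : nat) (x s : R) : R :=
  Rsum n (fun k => phase_term (a k) (x + s) - phase_term (a k) x).
Definition phase' (a : nat -> Cx) (n : nat) (x s : R) : R :=
  Rsum n (fun k => 2 * snd (a k) / ((x + s - fst (a k)) ^ 2 + snd (a k) ^ 2)).
Definition phase'' (a : nat -> Cx) (n : nat) (x s : R) : R :=
  Rsum n (fun k => - (4 * snd (a k) * (x + s - fst (a k)))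
                     / ((x + s - fst (a k)) ^ 2 + snd (a k) ^ 2) ^ 2).
(** Twice the real part collects the conjugate contributions of the indices [k] and [-(k + 1)].
    Unlike [sin (phase a n x s) / s], the sum is also meaningful and continuous at [s = 0]. *)
Definition kernel (a : nat -> Cx) (n : nat) (x s : R) : R :=
  Rsum n (fun k => 2 * fst (Cmul (Phiplus a k (RtoC x)) (Cconj (Phiplus a k (RtoC (x + s)))))).

Lemma cos_2_atan (u : R) : cos (2 * atan u) = (1 - u ^ 2) / (1 + u ^ 2).
Proof.
rewrite cos_2a_cos, cos_atan.
assert (H : 0 < 1 + u²) by (unfold Rsqr; nra).
assert (Hs : sqrt (1 + u²) * sqrt (1 + u²) = 1 + u²) by (apply sqrt_sqrt; lra).
pose proof (sqrt_lt_R0 _ H) as Hp.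
replace (2 * (1 / sqrt (1 + u²)) * (1 / sqrt (1 + u²)) - 1)
  with (2 / (sqrt (1 + u²) * sqrt (1 + u²)) - 1) by (field; lra).
rewrite Hs; unfold Rsqr in *; field; nra.
Qed.

Lemma sin_2_atan (u : R) : sin (2 * atan u) = 2 * u / (1 + u ^ 2).
Proof.
rewrite sin_2a, cos_atan, sin_atan.
assert (H : 0 < 1 + u²) by (unfold Rsqr; nra).
assert (Hs : sqrt (1 + u²) * sqrt (1 + u²) = 1 + u²) by (apply sqrt_sqrt; lra).
pose proof (sqrt_lt_R0 _ H) as Hp.
replace (2 * (u / sqrt (1 + u²)) * (1 / sqrt (1 + u²)))
  with (2 * u / (sqrt (1 + u²) * sqrt (1 + u²))) by (field; lra).
rewrite Hs; unfold Rsqr in *; field; nra.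
Qed.

Lemma Blaschke_factor_phase (w : Cx) (t : R) : 0 < snd w ->
  Cdiv (Csub (RtoC t) w) (Csub (RtoC t) (Cconj w))
    = (- cos (phase_term w t), - sin (phase_term w t)).
Proof.
intros Hw; pose proof (dist2_pos w t Hw) as H; rewrite Blaschke_factor; unfold phase_term.
rewrite cos_2_atan, sin_2_atan.
apply injective_projections; cbn [fst snd]; field; split; try split; nra.
Qed.

Lemma Bplus_phase (a : nat -> Cx) (n : nat) (x s : R) : (forall k, 0 < CIm (a k)) ->
  Cmul (Bplus a n (RtoC x)) (Cconj (Bplus a n (RtoC (x + s))))
    = (cos (phase a n x s), - sin (phase a n x s)).
Proof.
intros Ha; unfold Bplus, phase; induction n as [|n IH]; cbn [Cprod Rsum].
- rewrite cos_0, sin_0; Cx_ring.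
- rewrite Cconj_mul.
  set (P := Cprod n (fun k => Bfac (a k) (RtoC x))) in *.
  set (Q := Cconj (Cprod n (fun k => Bfac (a k) (RtoC (x + s))))) in *.
  set (psi := Rsum n (fun k => phase_term (a k) (x + s) - phase_term (a k) x)) in *.
  unfold Bfac; rewrite !Blaschke_factor_phase by apply Ha.
  set (u := phase_term (a n) x); set (v := phase_term (a n) (x + s)).
  pose proof (Cnorm2_chi (a n)) as Hc; set (c := chi (a n)) in *.
  (* The constant [c] enters only through its norm, which is [1], and the two minus signs cancel;
     the pair on the right is [exp (i (u - v))]. *)
  replace (Cmul (Cmul P (Cmul c (- cos u, - sin u)))
             (Cmul Q (Cconj (Cmul c (- cos v, - sin v)))))
    with (Cmul (Cscale (Cnorm2 c) (Cmul P Q))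
            (cos u * cos v + sin u * sin v, sin u * cos v - cos u * sin v))
    by (unfold Cnorm2; Cx_ring).
  rewrite Hc, IH, cos_plus, sin_plus, cos_minus, sin_minus; Cx_ring.
Qed.

(* Christoffel-Darboux: with [B] the Blaschke product, the k-th term times [2 i s] is
   [B_k(x) conj B_k(x+s) - B_(k+1)(x) conj B_(k+1)(x+s)], so the sum telescopes. *)
Lemma kernel_sin (a : nat -> Cx) (n : nat) (x s : R) : (forall k, 0 < CIm (a k)) ->
  kernel a n x s * s = sin (phase a n x s).
Proof.
intros Ha.
rewrite <- (Ropp_involutive (sin _)).
replace (- sin (phase a n x s))
  with (snd (Cmul (Bplus a n (RtoC x)) (Cconj (Bplus a n (RtoC (x + s))))))
  by (rewrite Bplus_phase by assumption; reflexivity).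
unfold kernel; induction n as [|n IH]; cbn [Rsum].
- unfold Bplus; simpl; ring.
- rewrite Rmult_plus_distr_r, IH; unfold Phiplus.
  change (Bplus a (S n) (RtoC x)) with (Cmul (Bplus a n (RtoC x)) (Bfac (a n) (RtoC x))).
  change (Bplus a (S n) (RtoC (x + s)))
    with (Cmul (Bplus a n (RtoC (x + s))) (Bfac (a n) (RtoC (x + s)))).
  set (P := Bplus a n (RtoC x)); set (Q := Bplus a n (RtoC (x + s))).
  pose proof (Cnorm2_chi (a n)) as Hc; unfold Bfac; set (c := chi (a n)) in *.
  rewrite !Blaschke_factor, !Cauchy_factor.
  pose proof (Ha n) as Hn; unfold CIm in *.
  pose proof (dist2_pos (a n) x Hn) as H1; pose proof (dist2_pos (a n) (x + s) Hn) as H2.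
  pose proof (sqrt_sqrt (snd (a n)) ltac:(lra)) as Hs; set (r := sqrt (snd (a n))) in *.
  set (al := fst (a n)) in *; set (be := snd (a n)) in *.
  set (u := Cmul P (Cconj Q)).
  (* Every term contains the common factor [P * conj Q]. Once it is taken out, a rational identity
     remains, with [be] written as the square of [r]. *)
  match goal with |- - snd u + 2 * fst (Cmul (Cmul ?e1 P) (Cconj (Cmul ?e2 Q))) * s
     = - snd (Cmul (Cmul P (Cmul c ?q1)) (Cconj (Cmul Q (Cmul c ?q2)))) =>
   replace (Cmul (Cmul e1 P) (Cconj (Cmul e2 Q))) with (Cmul (Cmul e1 (Cconj e2)) u)
     by (unfold u; Cx_ring);
   replace (Cmul (Cmul P (Cmul c q1)) (Cconj (Cmul Q (Cmul c q2))))
     with (Cscale (Cnorm2 c) (Cmul (Cmul q1 (Cconj q2)) u))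
     by (unfold u, Cnorm2; Cx_ring)
  end.
  rewrite Hc; clearbody u; destruct u as [p q].
  unfold Cscale, Cmul, Cconj; cbn [fst snd].
  rewrite <- Hs in *; field; lra.
Qed.

Lemma continuity_Rsum (n : nat) (u : nat -> R -> R) : (forall k, continuity (u k)) ->
  continuity (fun s => Rsum n (fun k => u k s)).
Proof.
intros H; induction n as [|n IH]; cbn [Rsum].
- intros s; apply continuity_pt_const; now intros ? ?.
- intros s; apply (continuity_pt_plus (fun s => Rsum n (fun k => u k s)) (u n)); [apply IH | apply H].
Qed.

Lemma continuity_kernel (a : nat -> Cx) (n : nat) (x : R) : (forall k, 0 < CIm (a k)) ->
  continuity (kernel a n x).
Proof.
intros Ha; unfold kernel; apply continuity_Rsum; intros k s.
apply (continuity_pt_mult (fun _ => 2)); [apply continuity_pt_const; now intros ? ?|].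
assert (H : Ccontinuous (fun t => Cmul (Phiplus a k (RtoC x)) (Cconj (Phiplus a k (RtoC t))))).
{ apply Ccontinuous_mul; [apply Ccontinuous_const|].
  apply Ccontinuous_conj.
  apply (Ccontinuous_ext (fun t => Phi a (Z.of_nat k) (RtoC t))); [intros; apply Phi_nonneg|].
  now apply Ccontinuous_Phi. }
apply (continuity_pt_comp (fun s => x + s)
  (fun t => fst (Cmul (Phiplus a k (RtoC x)) (Cconj (Phiplus a k (RtoC t)))))).
- apply (is_derive_continuity_pt _ _ 1); auto_derive; [trivial | ring].
- apply H.
Qed.

Lemma is_derive_Rsum (n : nat) (u : nat -> R -> R) (du : nat -> R) (s : R) :
  (forall k, is_derive (u k) s (du k)) ->
  is_derive (fun s => Rsum n (fun k => u k s)) s (Rsum n du).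
Proof.
intros H; induction n as [|n IH]; cbn [Rsum].
- apply (is_derive_const (V := R_NormedModule)).
- now apply (is_derive_plus (V := R_NormedModule) (fun s => Rsum n (fun k => u k s)) (u n)).
Qed.

Lemma is_derive_phase (a : nat -> Cx) (n : nat) (x s : R) : (forall k, 0 < CIm (a k)) ->
  is_derive (phase a n x) s (phase' a n x s).
Proof.
intros Ha; apply (is_derive_Rsum n (fun k s => phase_term (a k) (x + s) - phase_term (a k) x)).
intros k; pose proof (Ha k) as Hk; unfold CIm in Hk; pose proof (dist2_pos (a k) (x + s) Hk).
unfold phase_term; auto_derive; [trivial|]; unfold Rsqr; field; nra.
Qed.

Lemma is_derive_phase' (a : nat -> Cx) (n : nat) (x s : R) : (forall k, 0 < CIm (a k)) ->
  is_derive (phase' a n x) s (phase'' a n x s).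
Proof.
intros Ha; apply (is_derive_Rsum n
  (fun k s => 2 * snd (a k) / ((x + s - fst (a k)) ^ 2 + snd (a k) ^ 2))).
intros k; pose proof (dist2_pos (a k) (x + s) (Ha k)) as Hk.
auto_derive; simpl in *; [lra | field; lra].
Qed.

Lemma Rsum_le (n : nat) (u v : nat -> R) : (forall k, u k <= v k) -> Rsum n u <= Rsum n v.
Proof. intros H; induction n as [|n IH]; cbn [Rsum]; [lra | specialize (H n); lra]. Qed.

Lemma Rsum_scal (n : nat) (c : R) (u : nat -> R) : Rsum n (fun k => c * u k) = c * Rsum n u.
Proof. induction n as [|n IH]; cbn [Rsum]; [ring | rewrite IH; ring]. Qed.

Lemma Rabs_Rsum_le (n : nat) (u v : nat -> R) : (forall k, Rabs (u k) <= v k) ->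
  Rabs (Rsum n u) <= Rsum n v.
Proof.
intros H; induction n as [|n IH]; cbn [Rsum]; [rewrite Rabs_R0; lra|].
apply Rle_trans with (1 := Rabs_triang _ _); specialize (H n); lra.
Qed.

(** Termwise, [|t - a|^2 <= 2 (t^2 + |a|^2) <= 2 (1 + tau^2) (1 + |a|^2)]; the factor [2] cancels
    that of the derivative of [2 * atan]. *)
Lemma phase'_lower (a : nat -> Cx) (n : nat) (x s tau : R) : (forall k, 0 < CIm (a k)) ->
  Rabs (x + s) <= tau -> sigmaA a n / (1 + tau ^ 2) <= phase' a n x s.
Proof.
intros Ha Ht; unfold sigmaA, phase'.
unfold Rdiv at 1; rewrite Rmult_comm, <- Rsum_scal; apply Rsum_le; intros k.
pose proof (Ha k) as Hk; unfold CIm, Cnorm2 in *.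
pose proof (dist2_pos (a k) (x + s) Hk) as Hp.
rewrite Rabs_pos_eq by lra.
set (t := x + s) in *; set (al := fst (a k)) in *; set (be := snd (a k)) in *.
assert (Ht2 : t ^ 2 <= tau ^ 2)
  by (rewrite <- (pow2_abs t); apply pow_incr; split; [apply Rabs_pos | assumption]).
assert (Hq : 0 < 1 + (al * al + be * be)) by nra.
replace (/ (1 + tau ^ 2) * (be / (1 + (al * al + be * be))))
  with (be / ((1 + tau ^ 2) * (1 + (al * al + be * be)))) by (field; split; nra).
replace (2 * be / ((t - al) ^ 2 + be ^ 2)) with (be / (((t - al) ^ 2 + be ^ 2) / 2)) by (field; lra).
apply Rmult_le_compat_l; [lra|]; apply Rinv_le_contravar; [lra|].
pose proof (pow2_ge_0 (t + al)); pose proof (pow2_ge_0 be).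
assert (0 <= tau ^ 2 * (al * al + be * be)) by (apply Rmult_le_pos; [apply pow2_ge_0 | nra]).
lra.
Qed.

(** Termwise, [2 |p * be| <= p^2 + be^2] leaves [2 / (p^2 + be^2)], at most [2 / be^2] whatever the
    point. *)
Lemma phase''_upper (a : nat -> Cx) (n : nat) (x s : R) : (forall k, 0 < CIm (a k)) ->
  Rabs (phase'' a n x s) <= 2 * varsigmaA a n.
Proof.
intros Ha; unfold varsigmaA, phase''; rewrite <- Rsum_scal; apply Rabs_Rsum_le; intros k.
pose proof (Ha k) as Hk; unfold CIm in *; pose proof (dist2_pos (a k) (x + s) Hk) as Hp.
set (p := x + s - fst (a k)) in *; set (be := snd (a k)) in *.
assert (Hp2 : 0 < (p ^ 2 + be ^ 2) ^ 2) by now apply pow_lt.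
rewrite Rabs_div, Rabs_Ropp, (Rabs_pos_eq ((p ^ 2 + be ^ 2) ^ 2)) by lra.
apply Rle_trans with (2 * (p ^ 2 + be ^ 2) / (p ^ 2 + be ^ 2) ^ 2).
- apply Rmult_le_compat_r; [left; apply Rinv_0_lt_compat; now apply pow_lt|].
  pose proof (pow2_ge_0 (p + be)); pose proof (pow2_ge_0 (p - be)).
  apply Rabs_le; split; lra.
- replace (2 * (p ^ 2 + be ^ 2) / (p ^ 2 + be ^ 2) ^ 2) with (2 * / (p ^ 2 + be ^ 2)) by (field; lra).
  replace (1 / (be * be)) with (/ (be ^ 2)) by (field; lra).
  apply Rmult_le_compat_l; [lra|]; apply Rinv_le_contravar.
  + now apply pow_lt.
  + pose proof (pow2_ge_0 p); lra.
Qed.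

Lemma sigmaA_pos (a : nat -> Cx) (n : nat) : (forall k, 0 < CIm (a k)) -> (1 <= n)%nat ->
  0 < sigmaA a n.
Proof.
intros Ha Hn; unfold sigmaA.
assert (Hk : forall k, 0 < Rabs (CIm (a k)) / (1 + Cnorm2 (a k))).
{ intros k; apply Rdiv_lt_0_compat; [apply Rabs_pos_lt, Rgt_not_eq, Ha|].
  pose proof (Cnorm2_ge0 (a k)); lra. }
destruct n as [|n]; [lia|]; clear Hn; induction n as [|n IH]; cbn [Rsum] in *.
- specialize (Hk 0%nat); lra.
- specialize (Hk (S n)); lra.
Qed.

(** * Functions of bounded variation and the limit *)

Lemma Rsum_ext (n : nat) (u v : nat -> R) : (forall k, (k < n)%nat -> u k = v k) ->
  Rsum n u = Rsum n v.
Proof.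
induction n as [|n IH]; intros H; [reflexivity|]; cbn [Rsum].
rewrite IH, H; auto with arith.
Qed.

(** [W x] is the total variation on [(-oo, x]], a supremum over finite nondecreasing sequences that
    end at or before [x]. Appending [x] and [y] to such a sequence gives the inequality. *)
Lemma BV_variation_function (f : R -> Cx) : BV f ->
  exists W : R -> R, forall x y, x <= y -> Cmod (Csub (f y) (f x)) <= W y - W x.
Proof.
intros [V HV].
set (E := fun x r => exists n xs, (forall i, (i < n)%nat -> xs i <= xs (S i)) /\ xs n <= x /\
   r = Rsum n (fun i => Cmod (Csub (f (xs (S i))) (f (xs i))))).
assert (HE : forall x, {m : R | is_lub (E x) m}).
{ intros x; apply completeness.
  - exists V; intros r (n & xs & H1 & _ & ->); now apply HV.
  - exists 0, 0%nat, (fun _ => x); repeat split; [intros; lia | lra]. }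
exists (fun x => proj1_sig (HE x)); intros x y Hxy.
destruct (HE x) as [wx [Hx1 Hx2]], (HE y) as [wy [Hy1 Hy2]]; simpl.
assert (H : wx <= wy - Cmod (Csub (f y) (f x))); [|lra].
apply Hx2; intros r (n & xs & H1 & H2 & ->).
(* The increment from [xs n] to the appended point [x] is discarded later as nonnegative; only the
   one from [x] to [y] is kept. *)
set (ys := fun i => if (i <=? n)%nat then xs i else if (i =? S n)%nat then x else y).
assert (Y1 : forall i, (i <= n)%nat -> ys i = xs i)
  by (intros i Hi; unfold ys; now rewrite (proj2 (Nat.leb_le i n) Hi)).
assert (Y2 : ys (S n) = x).
{ unfold ys; rewrite (proj2 (Nat.leb_gt (S n) n)) by lia; now rewrite Nat.eqb_refl. }
assert (Y3 : ys (S (S n)) = y).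
{ unfold ys; rewrite (proj2 (Nat.leb_gt (S (S n)) n)) by lia.
  now rewrite (proj2 (Nat.eqb_neq (S (S n)) (S n))) by lia. }
assert (HU : E y (Rsum (S (S n)) (fun i => Cmod (Csub (f (ys (S i))) (f (ys i)))))).
{ exists (S (S n)), ys; repeat split.
  - intros i Hi; destruct (Nat.eq_dec i (S n)) as [->|]; [rewrite Y2, Y3; lra|].
    destruct (Nat.eq_dec i n) as [->|]; [rewrite Y2, Y1 by lia; lra|].
    rewrite !Y1 by lia; apply H1; lia.
  - rewrite Y3; lra. }
apply Hy1 in HU; cbn [Rsum] in HU; rewrite Y3, Y2, (Y1 n) in HU by lia.
rewrite (Rsum_ext n _ (fun i => Cmod (Csub (f (xs (S i))) (f (xs i))))) in HU.
- assert (0 <= Cmod (Csub (f x) (f (xs n)))) by apply sqrt_pos; lra.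
- intros k Hk; now rewrite !Y1 by lia.
Qed.

Lemma Rabs_fst_le_Cmod (z : Cx) : Rabs (fst z) <= Cmod z.
Proof.
unfold Cmod, Cnorm2; rewrite <- sqrt_Rsqr_abs; apply sqrt_le_1_alt; unfold Rsqr; nra.
Qed.

Lemma Rabs_snd_le_Cmod (z : Cx) : Rabs (snd z) <= Cmod z.
Proof.
unfold Cmod, Cnorm2; rewrite <- sqrt_Rsqr_abs; apply sqrt_le_1_alt; unfold Rsqr; nra.
Qed.

Lemma Cmod_le_add (z : Cx) : Cmod z <= Rabs (fst z) + Rabs (snd z).
Proof.
pose proof (Rabs_pos (fst z)); pose proof (Rabs_pos (snd z)).
unfold Cmod, Cnorm2; rewrite <- (sqrt_Rsqr (Rabs (fst z) + Rabs (snd z))) by lra.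
apply sqrt_le_1_alt; unfold Rsqr.
pose proof (Rsqr_abs (fst z)) as E1; pose proof (Rsqr_abs (snd z)) as E2.
unfold Rsqr in E1, E2; rewrite E1, E2; nra.
Qed.

(** Replaces the Jordan decomposition: [W] and [W + g] are both nondecreasing, and [g] is their
    difference. *)
Definition dominated_increments (g W : R -> R) : Prop :=
  forall x y, x <= y -> Rabs (g y - g x) <= W y - W x.

Definition lim_right (g : R -> R) (x0 l : R) : Prop :=
  forall eps, 0 < eps -> exists d, 0 < d /\ forall x, x0 < x < x0 + d -> Rabs (g x - l) < eps.

(** The limit is the infimum of [h] to the right of [x0], obtained as minus the supremum of
    [- h]. *)
Lemma nondecreasing_lim_right (h : R -> R) (x0 : R) : (forall x y, x <= y -> h x <= h y) ->
  exists l, lim_right h x0 l.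
Proof.
intros Hh.
destruct (completeness (fun r => exists x, x0 < x /\ r = - h x)) as [m [Hm1 Hm2]].
- exists (- h x0); intros r (x & Hx & ->); specialize (Hh x0 x ltac:(lra)); lra.
- exists (- h (x0 + 1)), (x0 + 1); split; [lra | reflexivity].
- exists (- m); intros eps He.
  destruct (Classical_Prop.classic (exists x, x0 < x /\ h x < - m + eps)) as [(x & Hx & Hl)|Hn].
  + exists (x - x0); split; [lra|]; intros y Hy.
    specialize (Hh y x ltac:(lra)).
    assert (- h y <= m) by (apply Hm1; exists y; split; [lra | reflexivity]).
    apply Rabs_lt_between; lra.
  + exfalso; assert (m <= m - eps); [|lra].
    apply Hm2; intros r (x & Hx & ->).
    destruct (Rlt_dec (h x) (- m + eps)); [|lra].
    exfalso; apply Hn; now exists x.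
Qed.

Lemma dominated_increments_lim_right (g W : R -> R) (x0 : R) : dominated_increments g W ->
  exists l k, lim_right g x0 l /\ lim_right W x0 k.
Proof.
intros H.
assert (HW : forall x y, x <= y -> W x <= W y).
{ intros x y Hxy; specialize (H x y Hxy); pose proof (Rabs_pos (g y - g x)); lra. }
destruct (nondecreasing_lim_right W x0 HW) as [k Hk].
destruct (nondecreasing_lim_right (fun x => W x + g x) x0) as [l Hl].
{ intros x y Hxy; specialize (H x y Hxy); apply Rabs_le_between in H; lra. }
exists (l - k), k; split; [|assumption]; intros eps He.
destruct (Hk (eps / 2)) as [d1 [Hd1 H1]]; [lra|].
destruct (Hl (eps / 2)) as [d2 [Hd2 H2]]; [lra|].
exists (Rmin d1 d2); split; [now apply Rmin_pos|]; intros x Hx.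
pose proof (Rmin_l d1 d2); pose proof (Rmin_r d1 d2).
specialize (H1 x ltac:(lra)); specialize (H2 x ltac:(lra)).
apply Rabs_lt_between in H1, H2; apply Rabs_lt_between; lra.
Qed.

(** [g] and [W] may jump at [x0]. Putting the right limits in place of the values makes the new [W']
    right continuous at [0], and the domination survives by a limit passage. *)
Lemma dominated_increments_right_extension (g W : R -> R) (x0 l k : R) :
  dominated_increments g W -> lim_right g x0 l -> lim_right W x0 k ->
  let g' := fun s => if Rle_dec s 0 then l else g (x0 + s) in
  let W' := fun s => if Rle_dec s 0 then k else W (x0 + s) in
  (forall x y, 0 <= x -> x <= y -> Rabs (g' y - g' x) <= W' y - W' x) /\
  (forall eps, 0 < eps -> exists d, 0 < d /\ forall s, 0 < s < d -> W' s - W' 0 < eps).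
Proof.
intros H Hl Hk g' W'.
split.
- intros x y Hx Hxy; unfold g', W'.
  destruct (Rle_dec x 0) as [Hx0|Hx0], (Rle_dec y 0) as [Hy0|Hy0]; try lra.
  + rewrite !Rminus_diag, Rabs_R0; lra.
  + apply le_epsilon; intros eps He.
    destruct (Hl (eps / 2)) as [d1 [Hd1 H1]]; [lra|].
    destruct (Hk (eps / 2)) as [d2 [Hd2 H2]]; [lra|].
    (* A point of [(0, y]] so close to [0] that both functions are within [eps / 2] of their limits;
       domination is applied between [s] and [y]. *)
    set (s := Rmin y (Rmin d1 d2 / 2)).
    assert (Hs : 0 < s) by (unfold s; apply Rmin_pos; [lra|]; pose proof (Rmin_pos d1 d2 Hd1 Hd2); lra).
    pose proof (Rmin_l y (Rmin d1 d2 / 2)) as A1; pose proof (Rmin_r y (Rmin d1 d2 / 2)) as A2.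
    fold s in A1, A2.
    pose proof (Rmin_l d1 d2); pose proof (Rmin_r d1 d2).
    specialize (H1 (x0 + s) ltac:(lra)); specialize (H2 (x0 + s) ltac:(lra)).
    specialize (H (x0 + s) (x0 + y) ltac:(lra)).
    apply Rabs_lt_between in H1, H2; apply Rabs_le_between in H; apply Rabs_le; lra.
  + apply H; lra.
- intros eps He; destruct (Hk eps He) as [d [Hd Hd']].
  exists d; split; [assumption|]; intros s Hs; unfold W'.
  destruct (Rle_dec s 0), (Rle_dec 0 0); try lra.
  specialize (Hd' (x0 + s) ltac:(lra)); apply Rabs_lt_between in Hd'; lra.
Qed.

(** * Translation, reflection and the two halves of the kernel *)

Lemma ex_RInt_shift (g : R -> R) (x0 a b : R) : (forall a b, ex_RInt g a b) ->
  ex_RInt (fun s => g (x0 + s)) a b.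
Proof.
intros H; apply ex_RInt_ext with (fun s => scal 1 (g (1 * s + x0))).
- intros s _; unfold scal; simpl; unfold mult; simpl; rewrite Rmult_1_l; f_equal; ring.
- now apply (ex_RInt_comp_lin (V := R_NormedModule) g 1 x0 a b).
Qed.

Lemma RInt_shift (g : R -> R) (x0 a b : R) : (forall a b, ex_RInt g a b) ->
  RInt (fun s => g (x0 + s)) a b = RInt g (x0 + a) (x0 + b).
Proof.
intros H.
replace (x0 + a) with (1 * a + x0) by ring; replace (x0 + b) with (1 * b + x0) by ring.
rewrite <- (RInt_comp_lin (V := R_CompleteNormedModule) g 1 x0 a b) by auto.
apply RInt_ext; intros s _; unfold scal; simpl; unfold mult; simpl.
rewrite Rmult_1_l; f_equal; ring.
Qed.

Lemma ex_RInt_reflect (g : R -> R) (a b : R) : (forall a b, ex_RInt g a b) ->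
  ex_RInt (fun s => g (- s)) a b.
Proof.
intros H; apply ex_RInt_ext with (fun s => opp (opp (g (- s)))).
- intros s _; apply (opp_opp (G := R_AbelianGroup)).
- apply (ex_RInt_opp (V := R_NormedModule)).
  destruct (H (- a) (- b)) as [l Hl]; exists l.
  now apply (is_RInt_comp_opp (V := R_NormedModule)).
Qed.

Lemma RInt_reflect (g : R -> R) (a b : R) : (forall a b, ex_RInt g a b) ->
  RInt (fun s => g (- s)) a b = RInt g (- b) (- a).
Proof.
intros H; transitivity (opp (RInt g (- a) (- b))).
- apply (is_RInt_unique (V := R_CompleteNormedModule)).
  apply (is_RInt_ext (V := R_NormedModule) (fun s => opp (opp (g (- s))))).
  + intros s _; apply (opp_opp (G := R_AbelianGroup)).
  + apply (is_RInt_opp (V := R_NormedModule)), (is_RInt_comp_opp (V := R_NormedModule)).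
    now apply (RInt_correct (V := R_CompleteNormedModule)).
- apply (opp_RInt_swap (V := R_CompleteNormedModule)); auto.
Qed.

Lemma ex_RInt_right_extension (g : R -> R) (l : R) (a b : R) : (forall a b, ex_RInt g a b) ->
  ex_RInt (fun s => if Rle_dec s 0 then l else g s) a b.
Proof.
intros H.
assert (H0 : forall c, ex_RInt (fun s => if Rle_dec s 0 then l else g s) 0 c).
{ intros c; destruct (Rle_dec 0 c) as [Hc|Hc].
  - apply ex_RInt_ext with g; [|apply H]; rewrite Rmin_left, Rmax_right by assumption.
    intros s Hs; destruct Rle_dec; [lra | reflexivity].
  - apply ex_RInt_ext with (fun _ => l); [|apply (ex_RInt_const (V := R_NormedModule))].
    rewrite Rmin_right, Rmax_left by lra.
    intros s Hs; destruct Rle_dec; [reflexivity | lra]. }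
apply (ex_RInt_Chasles (V := R_NormedModule)) with 0; [apply ex_RInt_swap|]; apply H0.
Qed.

Lemma right_half_limit (D phi lam mu : nat -> R -> R) (m : nat -> R)
    (T L : R) (g W : R -> R) (x0 l k : R) :
  0 < T -> 0 <= L ->
  (forall n, (1 <= n)%nat -> phase_kernel (D n) (phi n) (lam n) (mu n) T L (m n)) ->
  cv_infty m -> (forall a b, ex_RInt g a b) ->
  dominated_increments g W -> lim_right g x0 l -> lim_right W x0 k ->
  forall eps, 0 < eps -> exists N, forall n, (N <= n)%nat ->
    Rabs (RInt (fun s => g (x0 + s) * D n s) 0 T - PI / 2 * l) < eps.
Proof.
intros HT HL HP Hm Hg HW Hl Hk eps He.
destruct (dominated_increments_right_extension g W x0 l k HW Hl Hk) as [H1 H2].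
destruct (RInt_phase_kernels_limit D phi lam mu m T L _ _ HT HL HP Hm
  (fun a b => ex_RInt_right_extension (fun s => g (x0 + s)) l a b
     (fun a b => ex_RInt_shift g x0 a b Hg)) H1 H2 eps He) as [N HN].
exists N; intros n Hn; specialize (HN n Hn).
destruct (Rle_dec 0 0) as [_|]; [|lra].
(* The two integrands agree on the open interval [(0, T)]; the altered value at [0] does not affect
   the integral. *)
rewrite (RInt_ext (fun s => g (x0 + s) * D n s)
  (fun s => (if Rle_dec s 0 then l else g (x0 + s)) * D n s)); [assumption|].
rewrite Rmin_left, Rmax_right by lra; intros s Hs.
destruct (Rle_dec s 0); [lra | reflexivity].
Qed.

Lemma dominated_increments_reflect (g W : R -> R) : dominated_increments g W ->
  dominated_increments (fun x => g (- x)) (fun x => - W (- x)).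
Proof.
intros H x y Hxy; specialize (H (- y) (- x) ltac:(lra)).
rewrite Rabs_minus_sym; lra.
Qed.

(** Here the ratio hypothesis becomes the constant [L] of [phase_kernel]: twice [varsigma] is at
    most [2 |K| sigma], and [sigma] is at most [1 + tau^2] times the slope. *)
Lemma phase''_le_phase' (a : nat -> Cx) (K tau x s : R) (n : nat) :
  (forall k, 0 < CIm (a k)) -> (1 <= n)%nat -> varsigmaA a n / sigmaA a n <= K ->
  Rabs (x + s) <= tau ->
  Rabs (phase'' a n x s) <= 2 * Rabs K * (1 + tau ^ 2) * phase' a n x s.
Proof.
intros Ha Hn HK Ht; pose proof (sigmaA_pos a n Ha Hn) as Hs.
pose proof (phase''_upper a n x s Ha) as H1.
pose proof (phase'_lower a n x s tau Ha Ht) as H2.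
apply Rle_div_l in HK; [|assumption].
assert (Ht2 : 0 < 1 + tau ^ 2) by (pose proof (pow2_ge_0 tau); lra).
apply Rle_div_l in H2; [|assumption].
assert (H3 : K * sigmaA a n <= Rabs K * sigmaA a n)
  by (apply Rmult_le_compat_r; [lra | apply Rle_abs]).
apply (Rmult_le_compat_l (Rabs K)) in H2; [|apply Rabs_pos]; lra.
Qed.

Lemma phase_0 (a : nat -> Cx) (n : nat) (x : R) : phase a n x 0 = 0.
Proof.
unfold phase; induction n as [|n IH]; cbn [Rsum]; [reflexivity|].
rewrite IH, Rplus_0_r; ring.
Qed.

Lemma phase_kernel_right (a : nat -> Cx) (K T x : R) (n : nat) :
  (forall k, 0 < CIm (a k)) -> (1 <= n)%nat -> varsigmaA a n / sigmaA a n <= K ->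
  phase_kernel (kernel a n x) (phase a n x) (phase' a n x) (phase'' a n x) T
    (2 * Rabs K * (1 + (Rabs x + T) ^ 2)) (sigmaA a n / (1 + (Rabs x + T) ^ 2)).
Proof.
intros Ha Hn HK.
assert (Ht : forall s, 0 <= s <= T -> Rabs (x + s) <= Rabs x + T).
{ intros s Hs; apply Rle_trans with (1 := Rabs_triang _ _); rewrite (Rabs_pos_eq s); lra. }
split.
- apply Rdiv_lt_0_compat; [now apply sigmaA_pos|]; pose proof (pow2_ge_0 (Rabs x + T)); lra.
- apply phase_0.
- intros s; now apply is_derive_phase.
- intros s; now apply is_derive_phase'.
- intros s Hs; apply phase''_le_phase'; auto.
- intros s Hs; apply phase'_lower; auto.
- intros s Hs; rewrite <- kernel_sin by assumption; field; lra.
- now apply continuity_kernel.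
Qed.

Lemma is_derive_reflect (f : R -> R) (s l : R) : is_derive f (- s) l ->
  is_derive (fun s => f (- s)) s (- l).
Proof.
intros H; evar_last.
- apply (is_derive_comp (V := R_NormedModule) f Ropp); [exact H|].
  apply (is_derive_opp (V := R_NormedModule) (fun s => s)), (is_derive_id (K := R_AbsRing)).
- unfold scal, opp, one; simpl; unfold mult; simpl; ring.
Qed.

(** Under [s |-> - s] the phase becomes [- phase (- s)], which again vanishes at [0] and increases;
    the two sign changes in [sin (phase (- s)) / (- s)] compensate. *)
Lemma phase_kernel_left (a : nat -> Cx) (K T x : R) (n : nat) :
  (forall k, 0 < CIm (a k)) -> (1 <= n)%nat -> varsigmaA a n / sigmaA a n <= K ->
  phase_kernel (fun s => kernel a n x (- s)) (fun s => - phase a n x (- s))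
    (fun s => phase' a n x (- s)) (fun s => - phase'' a n x (- s)) T
    (2 * Rabs K * (1 + (Rabs x + T) ^ 2)) (sigmaA a n / (1 + (Rabs x + T) ^ 2)).
Proof.
intros Ha Hn HK.
assert (Ht : forall s, 0 <= s <= T -> Rabs (x + - s) <= Rabs x + T).
{ intros s Hs; apply Rle_trans with (1 := Rabs_triang _ _).
  rewrite Rabs_Ropp, (Rabs_pos_eq s); lra. }
split.
- apply Rdiv_lt_0_compat; [now apply sigmaA_pos|]; pose proof (pow2_ge_0 (Rabs x + T)); lra.
- rewrite Ropp_0, phase_0; ring.
- intros s; rewrite <- (Ropp_involutive (phase' a n x (- s))).
  apply (is_derive_opp (V := R_NormedModule) (fun s => phase a n x (- s))).
  now apply is_derive_reflect, is_derive_phase.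
- intros s; now apply is_derive_reflect, is_derive_phase'.
- intros s Hs; rewrite Rabs_Ropp; apply phase''_le_phase'; auto.
- intros s Hs; apply phase'_lower; auto.
- intros s Hs; rewrite sin_neg, <- kernel_sin by assumption; field; lra.
- intros s; apply (continuity_pt_comp Ropp (kernel a n x)).
  + apply continuity_pt_opp, derivable_continuous_pt, derivable_pt_id.
  + now apply continuity_kernel.
Qed.

Lemma Rabs_kernel_le (a : nat -> Cx) (n : nat) (x s : R) : (forall k, 0 < CIm (a k)) ->
  s <> 0 -> Rabs (kernel a n x s) <= / Rabs s.
Proof.
intros Ha Hs.
replace (kernel a n x s) with (sin (phase a n x s) * / s)
  by (rewrite <- kernel_sin by assumption; field; assumption).
rewrite Rabs_mult, Rabs_inv; rewrite <- (Rmult_1_l (/ Rabs s)) at 2.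
apply Rmult_le_compat_r; [left; now apply Rinv_0_lt_compat, Rabs_pos_lt|].
apply Rabs_le, SIN_bound.
Qed.

(** The kernel is at most [1 / T] in absolute value beyond distance [T] from [x0], so the tails are
    small for all [n] together. [T] has to be fixed first, because [L] and the lower bound for the
    slope depend on it. *)
Lemma kernel_ImpInt_limit (a : nat -> Cx) (K x0 : R) (g W h : R -> R) (A lr ll kr kl : R)
    (I : nat -> R) :
  (forall k, 0 < CIm (a k)) -> cv_infty (sigmaA a) ->
  (forall n, (1 <= n)%nat -> varsigmaA a n / sigmaA a n <= K) ->
  (forall a b, ex_RInt g a b) -> ImpInt h A -> (forall t, Rabs (g t) <= h t) ->
  dominated_increments g W -> lim_right g x0 lr -> lim_right W x0 kr ->
  lim_right (fun x => g (- x)) (- x0) ll -> lim_right (fun x => - W (- x)) (- x0) kl ->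
  (forall n, ImpInt (fun t => g t * kernel a n x0 (t - x0)) (I n)) ->
  forall eps, 0 < eps -> exists N, forall n, (N <= n)%nat ->
    Rabs (I n - PI / 2 * (ll + lr)) < eps.
Proof.
intros Ha Hsig HK Hg Hh Hgh HW Hlr Hkr Hll Hkl HI eps He.
assert (Hh0 : forall t, 0 <= h t) by (intros t; apply Rle_trans with (2 := Hgh t), Rabs_pos).
assert (Hhex : forall x y, ex_RInt h x y) by (intros; eapply ImpInt_ex; eassumption).
assert (HA : 0 <= A).
{ pose proof (ImpInt_RInt_le h A 0 0 Hh Hh0 (Rle_refl 0)) as H.
  now rewrite (RInt_point (V := R_CompleteNormedModule)) in H. }
(* Each tail is at most [A / T], so both together stay below [eps / 4]; the [1] keeps [T] positive
   when [A = 0]. *)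
set (T := 8 * (A + 1) / eps).
assert (HT : 0 < T) by (apply Rdiv_lt_0_compat; lra).
assert (HAT : 2 * (A * / T) <= eps / 4).
{ replace (eps / 4) with (2 * ((A + 1) * / T)) by (unfold T; field; lra).
  apply Rmult_le_compat_l; [lra|]; apply Rmult_le_compat_r; [|lra].
  left; now apply Rinv_0_lt_compat. }
set (L := 2 * Rabs K * (1 + (Rabs x0 + T) ^ 2)).
set (q := 1 + (Rabs x0 + T) ^ 2).
assert (Hq : 0 < q) by (unfold q; pose proof (pow2_ge_0 (Rabs x0 + T)); lra).
assert (HL : 0 <= L).
{ unfold L; fold q; pose proof (Rabs_pos K); apply Rmult_le_pos; lra. }
assert (Hm : cv_infty (fun n => sigmaA a n / q)).
{ intros B; destruct (Hsig (B * q)) as [N HN]; exists N; intros n Hn.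
  apply Rlt_div_r; auto. }
destruct (right_half_limit _ _ _ _ _ T L g W x0 lr kr HT HL
  (fun n Hn => phase_kernel_right a K T x0 n Ha Hn (HK n Hn)) Hm Hg HW Hlr Hkr (eps / 8))
  as [N1 HN1]; [lra|].
(* The left half is the right half of the reflected function at [- x0]. *)
destruct (right_half_limit _ _ _ _ _ T L (fun x => g (- x)) (fun x => - W (- x)) (- x0) ll kl HT HL
  (fun n Hn => phase_kernel_left a K T x0 n Ha Hn (HK n Hn)) Hm
  (fun a b => ex_RInt_reflect g a b Hg)
  (dominated_increments_reflect g W HW) Hll Hkl (eps / 8))
  as [N2 HN2]; [lra|].
exists (max N1 N2); intros n Hn.
specialize (HN1 n ltac:(lia)); specialize (HN2 n ltac:(lia)).
set (G := fun t => g t * kernel a n x0 (t - x0)).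
assert (HG : forall u v, ex_RInt G u v) by (intros; eapply ImpInt_ex, HI).
assert (E1 : RInt (fun s => g (x0 + s) * kernel a n x0 s) 0 T = RInt G x0 (x0 + T) :> R).
{ transitivity (RInt (fun s => G (x0 + s)) 0 T).
  - apply RInt_ext; intros s _; unfold G; now replace (x0 + s - x0) with s by ring.
  - rewrite RInt_shift by assumption; now rewrite Rplus_0_r. }
assert (E2 : RInt (fun s => g (- (- x0 + s)) * kernel a n x0 (- s)) 0 T
              = RInt G (x0 - T) x0 :> R).
{ transitivity (RInt (fun s => G (x0 + - s)) 0 T).
  - apply RInt_ext; intros s _; unfold G.
    replace (x0 + - s - x0) with (- s) by ring.
    now replace (- (- x0 + s)) with (x0 + - s) by ring.
  - rewrite (RInt_reflect (fun s => G (x0 + s))) by (intros; now apply ex_RInt_shift).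
    rewrite RInt_shift by assumption; now rewrite Ropp_0, Rplus_0_r. }
rewrite E1 in HN1; rewrite E2 in HN2.
assert (Htail : forall u v, u <= v -> (x0 + T <= u \/ v <= x0 - T) ->
  Rabs (RInt G u v) <= A * / T).
{ intros u v Huv Hout.
  apply Rle_trans with (RInt (fun t => / T * h t + 0 * h t) u v).
  - apply Rabs_RInt_le; [assumption | apply HG | now apply ex_RInt_comb |].
    intros t Ht; unfold G; rewrite Rabs_mult.
    replace (/ T * h t + 0 * h t) with (h t * / T) by ring.
    apply Rmult_le_compat; try apply Rabs_pos; [apply Hgh|].
    assert (HTt : T <= Rabs (t - x0)) by (unfold Rabs; destruct Rcase_abs; lra).
    assert (Htx : t - x0 <> 0) by (intros E; rewrite E, Rabs_R0 in HTt; lra).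
    apply Rle_trans with (1 := Rabs_kernel_le a n x0 (t - x0) Ha Htx).
    apply Rinv_le_contravar; lra.
  - rewrite RInt_comb by auto.
    pose proof (ImpInt_RInt_le h A u v Hh Hh0 Huv) as H.
    apply (Rmult_le_compat_l (/ T)) in H; [lra | left; now apply Rinv_0_lt_compat]. }
destruct (ImpInt_lim G (I n) (eps / 4) (HI n)) as [M [HM HMl]]; [lra|].
(* [[u, v]] contains both [[-M, M]], where the improper integral is nearly attained, and
   [[x0 - T, x0 + T]]. *)
set (u := Rmin (- M) (x0 - T)); set (v := Rmax M (x0 + T)).
assert (Hu : u <= x0 - T) by apply Rmin_r; assert (Hv : x0 + T <= v) by apply Rmax_r.
specialize (HMl u v (Rmin_l _ _) (Rmax_l _ _)).
rewrite (RInt_split G u v (x0 - T) HG), (RInt_split G (x0 - T) v (x0 + T) HG),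
  (RInt_split G (x0 - T) (x0 + T) x0 HG) in HMl.
pose proof (Htail u (x0 - T) Hu ltac:(lra)) as T1.
pose proof (Htail (x0 + T) v Hv ltac:(lra)) as T2.
apply Rabs_lt_between in HN1, HN2, HMl; apply Rabs_le_between in T1, T2.
apply Rabs_lt_between; lra.
Qed.

(** * The partial sum as an integral against the kernel *)

Lemma CImpInt_Cmul_const (F : R -> Cx) (J z : Cx) : CImpInt F J ->
  CImpInt (fun t => Cmul (F t) z) (Cmul J z).
Proof.
intros [H1 H2]; split.
- apply ImpInt_ext with (fun t => fst z * fst (F t) + - snd z * snd (F t)); [intros; simpl; ring|].
  simpl; replace (fst J * fst z - snd J * snd z) with (fst z * fst J + - snd z * snd J) by ring.
  now apply ImpInt_comb.
- apply ImpInt_ext with (fun t => snd z * fst (F t) + fst z * snd (F t)); [intros; simpl; ring|].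
  simpl; replace (fst J * snd z + snd J * fst z) with (snd z * fst J + fst z * snd J) by ring.
  now apply ImpInt_comb.
Qed.

Lemma CImpInt_Cadd (F G : R -> Cx) (I J : Cx) : CImpInt F I -> CImpInt G J ->
  CImpInt (fun t => Cadd (F t) (G t)) (Cadd I J).
Proof.
intros [F1 F2] [G1 G2]; split.
- apply ImpInt_ext with (fun t => 1 * fst (F t) + 1 * fst (G t)); [intros; simpl; ring|].
  simpl; replace (fst I + fst J) with (1 * fst I + 1 * fst J) by ring; now apply ImpInt_comb.
- apply ImpInt_ext with (fun t => 1 * snd (F t) + 1 * snd (G t)); [intros; simpl; ring|].
  simpl; replace (snd I + snd J) with (1 * snd I + 1 * snd J) by ring; now apply ImpInt_comb.
Qed.

Lemma CImpInt_ext (F G : R -> Cx) (J : Cx) : (forall t, F t = G t) -> CImpInt F J -> CImpInt G J.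
Proof.
intros E [H1 H2]; split.
- apply ImpInt_ext with (fun t => fst (F t)); [intros; now rewrite E | assumption].
- apply ImpInt_ext with (fun t => snd (F t)); [intros; now rewrite E | assumption].
Qed.

Lemma kernel_Csum (a : nat -> Cx) (n : nat) (x t : R) :
  Csum (2 * n) (fun j => Cmul (Cconj (Phi a (Z.of_nat j - Z.of_nat n) (RtoC t)))
                              (Phi a (Z.of_nat j - Z.of_nat n) (RtoC x)))
    = RtoC (kernel a n x (t - x)).
Proof.
rewrite (Csum_symmetric (fun k => Cmul (Cconj (Phi a k (RtoC t))) (Phi a k (RtoC x)))).
unfold kernel; replace (x + (t - x)) with t by ring.
induction n as [|n IH]; cbn [Csum Rsum]; [reflexivity|].
rewrite IH, !Phi_nonneg, !Phi_neg; Cx_ring.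
Qed.

(** Linearity of the improper integral over a finite sum; the factor [PI] absorbs the [/ PI] of each
    coefficient. *)
Lemma Spart_CImpInt (f : R -> Cx) (a : nat -> Cx) (c : Z -> Cx) (n : nat) (x : R) :
  (forall k, IsCoef f a k (c k)) ->
  CImpInt (fun t => Cmul (f t) (RtoC (kernel a n x (t - x)))) (Cscale PI (Spart a c n x)).
Proof.
intros Hc; pose proof PI_RGT_0 as HPI.
assert (Hstep : forall u z w,
  Cscale PI (Cadd u (Cmul (Cscale (/ PI) z) w)) = Cadd (Cscale PI u) (Cmul z w)).
{ intros u z w; apply injective_projections; simpl; field; lra. }
assert (H0 : CImpInt (fun _ => C0) C0).
{ split; apply ImpInt_intro; simpl.
  1, 3: intros; apply (ex_RInt_const (V := R_NormedModule)).
  all: intros eps He; exists 1; (split; [lra|]); intros u v _ _;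
    rewrite (RInt_const (V := R_CompleteNormedModule)); unfold scal; simpl; unfold mult; simpl;
    rewrite Rmult_0_r, Rminus_0_r, Rabs_R0; assumption. }
apply CImpInt_ext with (fun t => Csum (2 * n) (fun j =>
  Cmul (Cmul (f t) (Cconj (Phi a (Z.of_nat j - Z.of_nat n) (RtoC t))))
       (Phi a (Z.of_nat j - Z.of_nat n) (RtoC x)))).
{ intros t; rewrite <- kernel_Csum.
  generalize (2 * n)%nat as p; induction p as [|p IH]; cbn [Csum]; [Cx_ring|].
  rewrite IH; Cx_ring. }
unfold Spart; generalize (2 * n)%nat as p; induction p as [|p IH]; cbn [Csum].
- replace (Cscale PI C0) with C0 by Cx_ring; exact H0.
- destruct (Hc (Z.of_nat p - Z.of_nat n)%Z) as [J [HJ ->]].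
  rewrite Hstep; apply CImpInt_Cadd; [exact IH|]; now apply CImpInt_Cmul_const.
Qed.

Lemma L1_ex_RInt (f : R -> Cx) : L1 f ->
  (forall a b, ex_RInt (fun t => fst (f t)) a b) /\ (forall a b, ex_RInt (fun t => snd (f t)) a b).
Proof. intros [[l [H1 H2]] _]; split; intros; eapply ImpInt_ex; eassumption. Qed.

(** [Phi] is continuous and its components are bounded by some [M] on the real axis, so both
    components of the integrand are dominated by [2 * M * |f|]. *)
Lemma IsCoef_exists (f : R -> Cx) (a : nat -> Cx) (k : Z) : L1 f ->
  (forall k, 0 < CIm (a k)) -> exists c, IsCoef f a k c.
Proof.
intros Hf Ha; destruct (L1_ex_RInt f Hf) as [Hf1 Hf2]; destruct Hf as [_ [A HA]].
destruct (Ccontinuous_Phi a k Ha) as [C1 C2]; destruct (Phi_bounded a k Ha) as [M [HM HB]].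
assert (Hdom : ImpInt (fun t => (2 * M) * Cmod (f t) + 0 * Cmod (f t)) ((2 * M) * A + 0 * A))
  by now apply ImpInt_comb.
assert (Hex : forall u v, (forall a b, ex_RInt u a b) -> continuity v ->
  forall a b, ex_RInt (fun t => u t * v t) a b).
{ intros u v Hu Hv x y; apply ex_RInt_mult; [apply Hu | now apply continuity_ex_RInt]. }
assert (Hle : forall t u v p q, Rabs u <= Cmod (f t) -> Rabs v <= Cmod (f t) ->
  Rabs p <= M -> Rabs q <= M ->
  Rabs (1 * (u * p) + 1 * (v * q)) <= (2 * M) * Cmod (f t) + 0 * Cmod (f t) /\
  Rabs (1 * (v * q) + -1 * (u * p)) <= (2 * M) * Cmod (f t) + 0 * Cmod (f t)).
{ intros t u v p q Hu Hv Hp Hq.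
  assert (E1 : Rabs (u * p) <= Cmod (f t) * M)
    by (rewrite Rabs_mult; apply Rmult_le_compat; try apply Rabs_pos; assumption).
  assert (E2 : Rabs (v * q) <= Cmod (f t) * M)
    by (rewrite Rabs_mult; apply Rmult_le_compat; try apply Rabs_pos; assumption).
  apply Rabs_le_between in E1, E2; split; apply Rabs_le; lra. }
destruct (ImpInt_dominated
  (fun t => 1 * (fst (f t) * fst (Phi a k (RtoC t))) + 1 * (snd (f t) * snd (Phi a k (RtoC t))))
  _ _ ltac:(intros; apply ex_RInt_comb; apply Hex; auto) Hdom) as [I1 HI1].
{ intros t; apply Hle; [apply Rabs_fst_le_Cmod | apply Rabs_snd_le_Cmod | apply HB | apply HB]. }
destruct (ImpInt_dominated
  (fun t => 1 * (snd (f t) * fst (Phi a k (RtoC t))) + -1 * (fst (f t) * snd (Phi a k (RtoC t))))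
  _ _ ltac:(intros; apply ex_RInt_comb; apply Hex; auto) Hdom) as [I2 HI2].
{ intros t; apply Hle; [apply Rabs_fst_le_Cmod | apply Rabs_snd_le_Cmod | apply HB | apply HB]. }
exists (Cscale (/ PI) (I1, I2)), (I1, I2); split; [|reflexivity]; split.
- eapply ImpInt_ext; [|exact HI1]; intros t; simpl; ring.
- eapply ImpInt_ext; [|exact HI2]; intros t; simpl; ring.
Qed.

Lemma right_limit_pair (f : R -> Cx) (x0 l1 l2 : R) :
  lim_right (fun x => fst (f x)) x0 l1 -> lim_right (fun x => snd (f x)) x0 l2 ->
  right_limit f x0 (l1, l2).
Proof.
intros H1 H2 eps He.
destruct (H1 (eps / 2)) as [d1 [Hd1 D1]]; [lra|].
destruct (H2 (eps / 2)) as [d2 [Hd2 D2]]; [lra|].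
exists (Rmin d1 d2); split; [now apply Rmin_pos|]; intros x Hx.
pose proof (Rmin_l d1 d2); pose proof (Rmin_r d1 d2).
specialize (D1 x ltac:(lra)); specialize (D2 x ltac:(lra)).
apply Rle_lt_trans with (1 := Cmod_le_add _).
unfold Csub, Cadd, Copp; simpl; unfold Rminus in *; lra.
Qed.

Theorem theorem2 (f : R -> Cx) (a : nat -> Cx) :
  L1 f -> BV f ->
  (forall k, 0 < CIm (a k)) ->
  no_real_limit_points a ->
  cv_infty (sigmaA a) ->
  (exists K : R, forall n, (1 <= n)%nat -> varsigmaA a n / sigmaA a n <= K) ->
  forall x0 : R,
    (forall k : Z, exists c, IsCoef f a k c) /\
    exists Lm Lp : Cx, left_limit f x0 Lm /\ right_limit f x0 Lp /\
      forall c : Z -> Cx, (forall k, IsCoef f a k (c k)) ->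
        Ccv (fun n => Spart a c n x0) (Cscale (/ 2) (Cadd Lm Lp)).
Proof.
intros Hf HBV Ha _ Hsig [K HK] x0.
split; [intros k; now apply IsCoef_exists|].
destruct (L1_ex_RInt f Hf) as [Hf1 Hf2]; destruct Hf as [_ [A HA]].
destruct (BV_variation_function f HBV) as [W HW].
assert (W1 : dominated_increments (fun x => fst (f x)) W).
{ intros x y Hxy; apply Rle_trans with (2 := HW x y Hxy).
  apply Rle_trans with (2 := Rabs_fst_le_Cmod _); right; reflexivity. }
assert (W2 : dominated_increments (fun x => snd (f x)) W).
{ intros x y Hxy; apply Rle_trans with (2 := HW x y Hxy).
  apply Rle_trans with (2 := Rabs_snd_le_Cmod _); right; reflexivity. }
destruct (dominated_increments_lim_right _ _ x0 W1) as [r1 [k1 [Hr1 Hk1]]].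
destruct (dominated_increments_lim_right _ _ x0 W2) as [r2 [k2 [Hr2 Hk2]]].
(* Left limits at [x0] are obtained as right limits of the reflected function at [- x0]. *)
destruct (dominated_increments_lim_right _ _ (- x0) (dominated_increments_reflect _ _ W1))
  as [l1 [j1 [Hl1 Hj1]]].
destruct (dominated_increments_lim_right _ _ (- x0) (dominated_increments_reflect _ _ W2))
  as [l2 [j2 [Hl2 Hj2]]].
exists (l1, l2), (r1, r2); split; [|split].
- intros eps He.
  destruct (right_limit_pair (fun x => f (- x)) (- x0) l1 l2 Hl1 Hl2 eps He) as [d [Hd D]].
  exists d; split; [assumption|]; intros x Hx.
  rewrite <- (Ropp_involutive x); apply D; lra.
- now apply right_limit_pair.
- intros c Hc eps He; pose proof PI_RGT_0 as HPI.
  assert (HI : forall n, CImpInt (fun t => Cmul (f t) (RtoC (kernel a n x0 (t - x0))))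
                 (Cscale PI (Spart a c n x0))) by (intros n; now apply Spart_CImpInt).
  (* Each component receives [eps / 2], multiplied by [PI] because the integrals represent [PI]
     times the partial sum. *)
  assert (Heps : 0 < PI * (eps / 2)) by (apply Rmult_lt_0_compat; lra).
  destruct (kernel_ImpInt_limit a K x0 (fun x => fst (f x)) W (fun t => Cmod (f t)) A
    r1 l1 k1 j1 (fun n => PI * fst (Spart a c n x0)) Ha Hsig HK Hf1 HA
    (fun t => Rabs_fst_le_Cmod (f t)) W1 Hr1 Hk1 Hl1 Hj1) with (eps := PI * (eps / 2))
    as [N1 HN1]; [|assumption|].
  { intros n; apply ImpInt_ext with (2 := proj1 (HI n)); intros t; simpl; ring. }
  destruct (kernel_ImpInt_limit a K x0 (fun x => snd (f x)) W (fun t => Cmod (f t)) A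
    r2 l2 k2 j2 (fun n => PI * snd (Spart a c n x0)) Ha Hsig HK Hf2 HA
    (fun t => Rabs_snd_le_Cmod (f t)) W2 Hr2 Hk2 Hl2 Hj2) with (eps := PI * (eps / 2))
    as [N2 HN2]; [|assumption|].
  { intros n; apply ImpInt_ext with (2 := proj2 (HI n)); intros t; simpl; ring. }
  exists (max N1 N2); intros n Hn.
  specialize (HN1 n ltac:(lia)); specialize (HN2 n ltac:(lia)).
  apply Rle_lt_trans with (1 := Cmod_le_add _).
  assert (Hdiv : forall s l r, Rabs (PI * s - PI / 2 * (l + r)) < PI * (eps / 2) ->
    Rabs (s + - (/ 2 * (l + r))) < eps / 2).
  { intros s l r H.
    replace (PI * s - PI / 2 * (l + r)) with (PI * (s + - (/ 2 * (l + r)))) in H by field.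
    rewrite Rabs_mult, Rabs_pos_eq in H by lra.
    now apply Rmult_lt_reg_l with PI. }
  apply Hdiv in HN1, HN2; unfold Csub, Cadd, Copp, Cscale; simpl; lra.
Qed.
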